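(* Let $K$ be a number field, let $S$ be a finite set of primes of $K$ containing all archimedean ones, let $\mathcal O=\mathcal O_S$ be the ring of $S$-integers of $K$, and let $A=\begin{pmatrix} a & c \\ b & d \end{pmatrix}\in\mathrm{SL}_2(\mathcal O)$. For $k\ge 3$, we have $\dim V_k(A)=k-3$ unless $k=3$ and $c=0$. It is irreducible unless $k=4$ and $a=1$, or $k=5$ and $A=L(b)$. In the case $k\ge3$, with $c\ne0$ if $k=3$, $V_k(A)$ is also rational (or the union of two irreducible rational varieties) with a birational map $V_k(A)\to\mathbb A^{k-3}$ given by $$(x_1,\ldots,x_k)\mapsto(x_4,\ldots,x_k)$$ (with the other component given by $$(x_1,\ldots,x_k)\mapsto(x_3,x_5,\ldots,x_k)$$ in the case when $V_k(A)$ is reducible), and is inductively fibered.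
   Context: The ring of $S$-integers is $\mathcal O_S=\{x\in K\mid v(x)\ge 0\text{ for all primes } v\notin S\}$. Put $U(x)=\begin{pmatrix} 1 & x \\ 0 & 1 \end{pmatrix}$ and $L(x)=\begin{pmatrix} 1 & 0 \\ x & 1 \end{pmatrix}$. For $k\ge1$, $V_k(A)\subseteq\mathbb A^k$ is the affine variety with coordinates $x_1,\ldots,x_k$ defined by the entrywise equations of $A=L(x_1)U(x_2)L(x_3)U(x_4)\cdots$, an alternating product of $k$ factors beginning with $L(x_1)$, with last factor $L(x_k)$ if $k$ is odd and $U(x_k)$ if $k$ is even. The same definition is used for matrices $A$ of determinant $1$ over any extension field of $K$. The dimension is that of the variety over $K$. When $V_k(A)$ is reducible, the first displayed map is birational from one of its two components to $\mathbb A^{k-3}$, and the second displayed map is birational from the other component to $\mathbb A^{k-3}$. ''Inductively fibered'' refers to the following structure, defined by induction on $k$. For $k\ge4$, consider the fibration $V_k(A)\to\mathbb A^1$, $(x_1,\ldots,x_k)\mapsto x_k$. Its fibers are the varieties $V_{k-1}(A\,L(x_k)^{-1})$ for $k$ odd and $V_{k-1}(A\,U(x_k)^{-1})$ for $k$ even, and the generic fibers are again inductively fibered rational varieties (or unions of two irreducible rational varieties) of dimension $k-4$. For $k=3$, the starting case, there is no condition.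
   Formalization: The irreducibility claim is stated only outside the case k=3, c=0, a≠1, where V_3(A) is empty (e.g. A=diag(2,1/2) with the prime 2 in S) and hence not irreducible in the usual sense. *)

(* Defs.v *)
From Stdlib Require List.
From HB Require Import structures.
From mathcomp Require Import all_boot all_order all_algebra all_field.
From mathcomp Require Import classical_sets.
From mathcomp Require Import mpoly.

Set Implicit Arguments.
Unset Strict Implicit.
Unset Printing Implicit Defensive.

Import Order.TTheory GRing.Theory Num.Theory.

Local Open Scope ring_scope.
Local Open Scope classical_set_scope.

(** * Primes of a number field and S-integers *)

(* Normalised discrete valuations.  The value at 0, which should be +oo, is
   left unconstrained: every clause, and every use, concerns nonzero elements
   only. *)
Record valuation (K : fieldType) := Valuation {
  val_fun :> K -> int;
  _ : forall x y : K, x != 0 -> y != 0 -> val_fun (x * y) = val_fun x + val_fun y;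
  _ : forall x y : K, x != 0 -> y != 0 -> x + y != 0 ->
        Num.min (val_fun x) (val_fun y) <= val_fun (x + y);
  _ : forall m : int, exists2 x : K, x != 0 & val_fun x = m
}.

(* The complex embeddings of a number field take their values in algC. *)
Inductive nf_prime (K : fieldExtType rat) :=
  | ArchPrime of {rmorphism K -> algC}
  | FinPrime of valuation K.

Arguments ArchPrime {K}.
Arguments FinPrime {K}.

(* Conjugate embeddings define the same archimedean prime; valuations that
   differ only at 0 define the same finite prime. *)
Definition same_prime (K : fieldExtType rat) (p q : nf_prime K) : Prop :=
  match p, q with
  | ArchPrime s, ArchPrime t =>
      (forall x, s x = t x) \/ (forall x, s x = (t x)^*)
  | FinPrime v, FinPrime w => forall x : K, x != 0 -> v x = w x
  | _, _ => False
  end.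

(* A finite set of primes is given by a list of representatives. *)
Definition in_primes (K : fieldExtType rat) (S : seq (nf_prime K))
    (p : nf_prime K) : Prop :=
  exists q, List.In q S /\ same_prime p q.

(* Used for S containing all archimedean primes, so that only finite primes
   impose a condition; 0 is an S-integer, as v(0) = +oo. *)
Definition S_integers (K : fieldExtType rat) (S : seq (nf_prime K)) : set K :=
  [set x | forall v : valuation K,
     ~ in_primes S (FinPrime v) -> x != 0 -> 0 <= v x].

Definition SL2 (R : comNzRingType) (O : set R) : set 'M[R]_2 :=
  [set A : 'M[R]_2 | (forall i j, O (A i j)) /\ \det A = 1].

(** * The K-Zariski topology on affine space

   F is the base field and Omega an algebraically closed extension of F, given
   by iota : F -> Omega.  An affine variety over F is identified with its set
   of Omega-points in Omega^k, and the closed sets are the zero loci of sets of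
   polynomials with coefficients in F; irreducibility, dimension and
   rationality below are thus relative to F. *)

Notation "''A[' W ]_ k" := {ffun 'I_k -> W}
  (at level 8, k at level 2, format "''A[' W ]_ k") : type_scope.

Section Zariski.
Variables (F : fieldType) (Omega : closedFieldType).
Variable iota : {rmorphism F -> Omega}.

Definition peval k (p : {mpoly F[k]}) (x : 'A[Omega]_k) : Omega :=
  mmap iota x p.

Definition zclosed k (X : set 'A[Omega]_k) : Prop :=
  exists I : set {mpoly F[k]}, X = [set x | forall p, I p -> peval p x = 0].

Definition zopen_in k (X U : set 'A[Omega]_k) : Prop :=
  exists C, zclosed C /\ U = X `\` C.

Definition zdense_in k (X U : set 'A[Omega]_k) : Prop :=
  U `<=` X /\ forall C, zclosed C -> U `<=` C -> X `<=` C.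

Definition zirreducible k (X : set 'A[Omega]_k) : Prop :=
  X !=set0 /\
  forall Y Z, zclosed Y -> zclosed Z -> X `<=` Y `|` Z -> X `<=` Y \/ X `<=` Z.

Definition irreducible_component k (X Z : set 'A[Omega]_k) : Prop :=
  [/\ zclosed Z, zirreducible Z, Z `<=` X &
      forall Y, zclosed Y -> zirreducible Y -> Y `<=` X -> Z `<=` Y -> Y = Z].

Definition irreducible_chain k (X : set 'A[Omega]_k) (m : nat)
    (Z : nat -> set 'A[Omega]_k) : Prop :=
  (forall i, (i <= m)%N -> [/\ zclosed (Z i), zirreducible (Z i) & Z i `<=` X])
  /\ (forall i, (i < m)%N -> Z i `<` Z i.+1).

(* [zdim X m]: the closed set X has dimension m.  It holds for no m when X is
   empty. *)
Definition zdim k (X : set 'A[Omega]_k) (m : nat) : Prop :=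
  (exists Z, irreducible_chain X m Z) /\
  (forall l Z, irreducible_chain X l Z -> (l <= m)%N).

Definition regular_fun k (U : set 'A[Omega]_k) (f : 'A[Omega]_k -> Omega) :
    Prop :=
  forall x, U x -> exists N (p q : {mpoly F[k]}),
    [/\ zopen_in U N, N x &
        forall y, N y -> peval q y != 0 /\ f y = peval p y / peval q y].

Definition regular_map k n (U : set 'A[Omega]_k)
    (f : 'A[Omega]_k -> 'A[Omega]_n) : Prop :=
  forall j, regular_fun U (fun x => f x j).

(* The rational map from X to A^n represented by phi is birational: phi
   restricts to an isomorphism between dense open subsets.  Values of phi
   outside U are irrelevant. *)
Definition birational_to_affine k n (X : set 'A[Omega]_k)
    (phi : 'A[Omega]_k -> 'A[Omega]_n) : Prop :=
  exists (U : set 'A[Omega]_k) (W : set 'A[Omega]_n)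
         (psi : 'A[Omega]_n -> 'A[Omega]_k),
  [/\ zopen_in X U /\ zdense_in X U,
      zopen_in setT W /\ zdense_in setT W,
      regular_map U phi /\ regular_map W psi,
      forall x, U x -> W (phi x) /\ psi (phi x) = x &
      forall y, W y -> U (psi y) /\ phi (psi y) = y].

Definition rational_variety k (X : set 'A[Omega]_k) : Prop :=
  zirreducible X /\
  exists n (phi : 'A[Omega]_k -> 'A[Omega]_n), birational_to_affine X phi.

Definition rational_or_union k (X : set 'A[Omega]_k) : Prop :=
  rational_variety X \/
  exists Z1 Z2, [/\ zclosed Z1, zclosed Z2, rational_variety Z1,
                    rational_variety Z2 & X = Z1 `|` Z2].

End Zariski.

(** * The varieties V_k(A) *)

Definition mx2 (R : nzRingType) (p q r s : R) : 'M[R]_2 :=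
  \matrix_(i < 2, j < 2)
    if i == ord0 then if j == ord0 then p else q
    else if j == ord0 then r else s.

Definition Umx (R : nzRingType) (x : R) : 'M[R]_2 := mx2 1 x 0 1.
Definition Lmx (R : nzRingType) (x : R) : 'M[R]_2 := mx2 1 0 x 1.

(* Coordinates are numbered from 0 in the code: x_(j+1) is [x j], so that the
   factor of index j is lower triangular exactly when j is even. *)
Definition elem_factor (R : nzRingType) (j : nat) (x : R) : 'M[R]_2 :=
  if odd j then Umx x else Lmx x.

Definition Vk (F : fieldType) (Omega : closedFieldType)
    (iota : {rmorphism F -> Omega}) (k : nat) (A : 'M[F]_2) :
    set 'A[Omega]_k :=
  [set x | map_mx iota A = \prod_(j < k) elem_factor j (x j)].

Arguments Vk {F Omega} iota k A _.

(* The coordinate x_i for 1 <= i <= k; the value 0 for other i is never used. *)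
Definition coord_at (R : nzRingType) k (x : 'A[R]_k) (i : nat) : R :=
  oapp x 0 (insub i.-1 : option 'I_k).

(* (x_1, ..., x_k) |-> (x_4, ..., x_k) *)
Definition proj_main (R : nzRingType) k (x : 'A[R]_k) : 'A[R]_(k - 3) :=
  [ffun j : 'I_(k - 3) => coord_at x (j + 4)].

(* (x_1, ..., x_k) |-> (x_3, x_5, ..., x_k) *)
Definition proj_other (R : nzRingType) k (x : 'A[R]_k) : 'A[R]_(k - 3) :=
  [ffun j : 'I_(k - 3) => coord_at x (if j == 0%N :> nat then 3 else j + 4)%N].

(** * Inductively fibered *)

Definition append_coord (R : nzRingType) k (x : 'A[R]_k) (t : R) : 'A[R]_k.+1 :=
  [ffun j : 'I_k.+1 => oapp x t (unlift ord_max j)].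

Definition fiber_last (R : nzRingType) k (X : set 'A[R]_k.+1) (t : R) :
    set 'A[R]_k :=
  [set x | X (append_coord x t)].

(* The statement is about V_(k+1)(A), fibered over A^1 by its last coordinate;
   the condition is empty unless k+1 >= 4.  The generic fibers are the fibers
   over all points t, with values in arbitrary extension fields F' of F, of a
   nonempty open subset g <> 0 of A^1; the generic point, t = 'X in F' = F(X),
   is one of them.  The fiber over t is a variety over F'. *)
Fixpoint inductively_fibered (k : nat) (F : fieldType) (A : 'M[F]_2) : Prop :=
  if k is k'.+1 then
    (4 <= k'.+1)%N ->
    exists2 g : {poly F}, g != 0 &
      forall (F' : fieldType) (i : {rmorphism F -> F'}) (t : F'),
      ~~ root (map_poly i g) t ->
      let A' := map_mx i A in
      let B := A' *m invmx (elem_factor k' t) in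
      inductively_fibered k' B /\
      forall (Omega : closedFieldType) (iota : {rmorphism F' -> Omega}),
      let X := fiber_last (Vk iota k'.+1 A') (iota t) in
      [/\ X = Vk iota k' B,
          zdim iota X (k'.+1 - 4) &
          rational_or_union iota X]
  else True.

(* Main.v *)
Require Import Defs.
From mathcomp Require Import all_boot all_order all_algebra all_field.
From mathcomp Require Import boolp classical_sets.
From mathcomp Require Import mpoly ring zify.

(* On the part x_2 <> 0 of V_k(A) the last k - 3 coordinates determine x_1, x_2,
   x_3 rationally, so this part is a nonempty principal open subset of A^(k-3).
   A point with x_2 = 0 is a limit of points with x_2 <> 0 along an explicit
   rational curve, obtained by rewriting a short product of elementary matrices,
   except if k = 4, a = 1 or k = 5, A = L(b), where V_k(A) is a union of two
   affine linear spaces.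

   For the dimension, a chain of irreducible closed sets of length l gives l
   algebraically independent functions on its largest member, while V_k(A) is
   covered by pieces whose coordinates are rational functions of k - 3 of them;
   counting monomials, n + 1 rational functions of n parameters are algebraically
   dependent.  In the other direction, the closures of the images of coordinate
   subspaces of A^(k-3) form a chain of length k - 3. *)

Set Implicit Arguments.
Unset Strict Implicit.
Unset Printing Implicit Defensive.

Import Order.TTheory GRing.Theory Num.Theory.

Local Open Scope ring_scope.
Local Open Scope classical_set_scope.

(** * Closed sets and rational curves *)

(** Closed sets, irreducibility and dimension refer to polynomials over F, and Omega may be
    algebraic over F, so that an irreducible set need not have a generic point. Irreducibility and
    density are therefore tested along curves with coefficients in Omega: a polynomial that vanishes
    at almost all points of such a curve vanishes wherever the curve is defined. Algebraic
    dependence likewise rests on linear algebra over F, without function fields. The parametrisation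
    comes from L(x) U(y) L(z), with upper right entry y and diagonal entries 1 + yz and 1 + xy: if y
    is nonzero, x and z can be read off, and the lower left entry is forced by the determinant. For
    y = 0 the product collapses to L(x + z), which frees one parameter. This is the source of the
    second component for small k; for larger k the remaining factors leave room to move x_2 away
    from 0. The base field is arbitrary because the fibers of the fibration live over arbitrary
    extensions of K. *)

Section FunctionRings.
Variables (F : fieldType) (Omega : closedFieldType).
Variable iota : {rmorphism F -> Omega}.
Variable T : Type.
Implicit Types (S : (T -> Omega) -> Prop) (E : set T) (f g d : T -> Omega).

(** A predicate on functions, so that one set of closure lemmas serves polynomial functions on
    affine space, polynomials in a curve parameter, pullbacks along a map, and localisations of all
    these. *)
Definition fun_subring S : Prop :=
  [/\ forall c : F, S (fun=> iota c),
      forall f g, S f -> S g -> S (fun x => f x + g x) &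
      forall f g, S f -> S g -> S (fun x => f x * g x)].

(* The localisation of S at d, as functions on E; the values outside E do not
   matter. *)
Definition loc_on E d S f : Prop :=
  exists N g, S g /\ forall x, E x -> f x * d x ^+ N = g x.

Section Closure.
Variable S : (T -> Omega) -> Prop.
Hypothesis HS : fun_subring S.

Lemma fsub_const (c : F) : S (fun=> iota c). Proof. by case: HS. Qed.

Lemma fsubD f g : S f -> S g -> S (fun x => f x + g x).
Proof. by case: HS => _ + _; apply. Qed.

Lemma fsubM f g : S f -> S g -> S (fun x => f x * g x).
Proof. by case: HS => _ _; apply. Qed.

Lemma fsub0 : S (fun=> 0).
Proof. by rewrite -(rmorph0 iota); apply: fsub_const. Qed.

Lemma fsub1 : S (fun=> 1).
Proof. by rewrite -(rmorph1 iota); apply: fsub_const. Qed.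

Lemma fsubN f : S f -> S (fun x => - f x).
Proof.
move=> Sf; have -> : (fun x => - f x) = (fun x => iota (-1) * f x).
  by apply/funext => x; rewrite rmorphN1 mulN1r.
exact/fsubM/Sf/fsub_const.
Qed.

Lemma fsubB f g : S f -> S g -> S (fun x => f x - g x).
Proof. by move=> Sf /fsubN; apply: fsubD. Qed.

Lemma fsubX f n : S f -> S (fun x => f x ^+ n).
Proof.
move=> Sf; elim: n => [|n IHn]; first exact: fsub1.
have -> : (fun x => f x ^+ n.+1) = (fun x => f x * f x ^+ n).
  by apply/funext => x; rewrite exprS.
exact: fsubM.
Qed.

Lemma fsub_sum (I : Type) (r : seq I) (h : I -> T -> Omega) :
  (forall i, S (h i)) -> S (fun x => \sum_(i <- r) h i x).
Proof.
move=> Sh; elim: r => [|i r IHr].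
  by under eq_fun do rewrite big_nil; apply: fsub0.
by under eq_fun do rewrite big_cons; apply: fsubD.
Qed.

Lemma fsub_prod (I : Type) (r : seq I) (h : I -> T -> Omega) :
  (forall i, S (h i)) -> S (fun x => \prod_(i <- r) h i x).
Proof.
move=> Sh; elim: r => [|i r IHr].
  by under eq_fun do rewrite big_nil; apply: fsub1.
by under eq_fun do rewrite big_cons; apply: fsubM.
Qed.

Lemma fsub_peval k (p : {mpoly F[k]}) (gam : T -> 'A[Omega]_k) :
  (forall i, S (fun t => gam t i)) -> S (fun t => peval iota p (gam t)).
Proof.
move=> Sg; rewrite /peval /mmap; apply: fsub_sum => m.
apply: fsubM; first exact: fsub_const.
by rewrite /mmap1; apply: fsub_prod => i; apply: fsubX.
Qed.

Lemma loc_on_subring E d : S d -> fun_subring (loc_on E d S).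
Proof.
move=> Sd; split=> [c|f g [N [f' [Sf' Ef]]] [M [g' [Sg' Eg]]]|].
- exists 0%N, (fun=> iota c); split; first exact: fsub_const.
  by move=> x _; rewrite mulr1.
- exists (N + M)%N, (fun x => f' x * d x ^+ M + g' x * d x ^+ N); split.
    by apply: fsubD; apply: fsubM => //; apply: fsubX.
  by move=> x Ex; rewrite -Ef // -Eg // exprD; ring.
- move=> f g [N [f' [Sf' Ef]]] [M [g' [Sg' Eg]]].
  exists (N + M)%N, (fun x => f' x * g' x); split; first exact: fsubM.
  by move=> x Ex; rewrite -Ef // -Eg // exprD; ring.
Qed.

Lemma loc_on_base E d f : S f -> loc_on E d S f.
Proof. by move=> Sf; exists 0%N, f; split=> // x _; rewrite mulr1. Qed.

Lemma loc_on_div E d f : (forall x, E x -> d x != 0) ->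
  S f -> loc_on E d S (fun x => f x / d x).
Proof.
by move=> dE Sf; exists 1%N, f; split=> // x /dE dx; rewrite expr1 divfK.
Qed.

End Closure.
End FunctionRings.

Section Zariski.
Variables (F : fieldType) (Omega : closedFieldType).
Variable iota : {rmorphism F -> Omega}.
Variable k : nat.
Implicit Types (X Y Z C : set 'A[Omega]_k) (p : {mpoly F[k]}).

Lemma pevalD p1 p2 x : peval iota (p1 + p2) x = peval iota p1 x + peval iota p2 x.
Proof. exact: raddfD. Qed.

Lemma pevalN p x : peval iota (- p) x = - peval iota p x.
Proof. exact: raddfN. Qed.

Lemma pevalM p1 p2 x : peval iota (p1 * p2) x = peval iota p1 x * peval iota p2 x.
Proof. exact: rmorphM. Qed.

Lemma peval0 x : peval iota (0 : {mpoly F[k]}) x = 0.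
Proof. exact: raddf0. Qed.

Lemma peval_sum (I : finType) (f : I -> {mpoly F[k]}) x :
  peval iota (\sum_i f i) x = \sum_i peval iota (f i) x.
Proof. exact: raddf_sum. Qed.

Lemma pevalZ c p x : peval iota (c *: p) x = iota c * peval iota p x.
Proof. by rewrite -mul_mpolyC pevalM; congr (_ * _); apply: mmapC. Qed.

Lemma pevalXn p n x : peval iota (p ^+ n) x = peval iota p x ^+ n.
Proof. exact: rmorphXn. Qed.

Lemma pevalC c x : peval iota (c%:MP_[k]) x = iota c.
Proof. exact: mmapC. Qed.

Lemma pevalX i (x : 'A[Omega]_k) : peval iota 'X_i x = x i.
Proof. by rewrite /peval mmapX mmap1U. Qed.

Definition vanishes p X : Prop := forall x, X x -> peval iota p x = 0.

Definition zclosure X : set 'A[Omega]_k :=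
  [set x | forall p, vanishes p X -> peval iota p x = 0].

Lemma sub_zclosure X : X `<=` zclosure X.
Proof. by move=> x Xx p; apply. Qed.

Lemma zclosed_zclosure X : zclosed iota (zclosure X).
Proof. by exists [set p | vanishes p X]. Qed.

Lemma zclosure_min X C : zclosed iota C -> X `<=` C -> zclosure X `<=` C.
Proof.
by move=> [I ->] XC x clx p Ip; apply: clx => y Xy; apply: (XC y Xy p).
Qed.

Lemma zclosureS X Y : X `<=` Y -> zclosure X `<=` zclosure Y.
Proof.
by move=> XY; apply: zclosure_min (zclosed_zclosure Y) _ => x /XY /sub_zclosure.
Qed.

Lemma zclosed_eq X : zclosed iota X -> zclosure X = X.
Proof.
move=> clX; apply/seteqP; split; last exact: sub_zclosure.
exact: zclosure_min.
Qed.

Lemma zclosure_idem X : zclosure (zclosure X) = zclosure X.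
Proof. exact/zclosed_eq/zclosed_zclosure. Qed.

Lemma zclosed_zeros p : zclosed iota [set x | peval iota p x = 0].
Proof.
exists [set p]; apply/seteqP; split=> x /=; first by move=> px _ ->.
by apply.
Qed.

Lemma zclosedI X Y : zclosed iota X -> zclosed iota Y -> zclosed iota (X `&` Y).
Proof.
move=> [I ->] [J ->]; exists (I `|` J); apply/seteqP; split=> x /=.
  by move=> [HI HJ] p [/HI|/HJ].
by move=> H; split=> p Ip; apply: H; [left|right].
Qed.

Lemma zirreducible_dense X Y : X `<=` Y -> Y `<=` zclosure X ->
  zirreducible iota X -> zirreducible iota Y.
Proof.
move=> XY YX [[x0 Xx0] irrX]; split; first by exists x0; apply: XY.
move=> C D clC clD YCD.
case: (irrX C D clC clD (subset_trans XY YCD)) => XC; [left|right];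
  apply: (subset_trans YX); exact: zclosure_min.
Qed.

Lemma zirreducible_zclosure X :
  zirreducible iota X -> zirreducible iota (zclosure X).
Proof. by apply: zirreducible_dense => //; apply: sub_zclosure. Qed.

(** Primality of the vanishing ideal: the zero loci of p and q are closed and cover X. *)
Lemma zirreducible_vanishes X p q : zirreducible iota X ->
  (forall x, X x -> peval iota p x * peval iota q x = 0) ->
  vanishes p X \/ vanishes q X.
Proof.
move=> [_ irrX] pq0; apply: (irrX _ _ (zclosed_zeros p) (zclosed_zeros q)).
by move=> x /pq0 /eqP; rewrite mulf_eq0 => /orP[]/eqP; [left|right].
Qed.

Lemma zirreducible_set1 (x : 'A[Omega]_k) : zirreducible iota [set x].
Proof.
split; first by exists x.
by move=> Y Z _ _ /(_ x erefl)[Yx|Zx]; [left|right] => _ ->.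
Qed.

Lemma zdense_in_closure X U : U `<=` X -> X `<=` zclosure U -> zdense_in iota X U.
Proof.
by move=> UX XU; split=> // C clC UC; apply: (subset_trans XU); apply: zclosure_min.
Qed.

End Zariski.

Section PolynomialMaps.
Variables (F : fieldType) (Omega : closedFieldType).
Variable iota : {rmorphism F -> Omega}.
Variable k : nat.

Definition polyfun (f : 'A[Omega]_k -> Omega) : Prop :=
  exists p : {mpoly F[k]}, forall x, f x = peval iota p x.

Lemma polyfun_subring : fun_subring iota polyfun.
Proof.
split=> [c|f g [p Hp] [q Hq]|f g [p Hp] [q Hq]].
- by exists c%:MP => x; rewrite pevalC.
- by exists (p + q) => x; rewrite pevalD Hp Hq.
- by exists (p * q) => x; rewrite pevalM Hp Hq.
Qed.

Lemma polyfun_coord i : polyfun (fun x : 'A[Omega]_k => x i).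
Proof. by exists 'X_i => x; rewrite pevalX. Qed.

Lemma zclosed_polyfun_eq f g : polyfun f -> polyfun g ->
  zclosed iota [set x | f x = g x].
Proof.
move=> [p Hp] [q Hq].
have -> : [set x | f x = g x] = [set x | peval iota (p - q) x = 0].
  apply/seteqP; split=> x /=; rewrite pevalD pevalN -Hp -Hq.
    by move=> ->; rewrite subrr.
  by move/eqP; rewrite subr_eq0 => /eqP.
exact: zclosed_zeros.
Qed.

End PolynomialMaps.

Section RationalCurves.
Variables (F : fieldType) (Omega : closedFieldType).
Variable iota : {rmorphism F -> Omega}.

Definition polyfun1 (f : Omega -> Omega) : Prop :=
  exists P : {poly Omega}, forall t, f t = P.[t].

Lemma polyfun1_subring : fun_subring iota polyfun1.
Proof.
split=> [c|f g [p Hp] [q Hq]|f g [p Hp] [q Hq]].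
- by exists (iota c)%:P => x; rewrite hornerC.
- by exists (p + q) => x; rewrite hornerD Hp Hq.
- by exists (p * q) => x; rewrite hornerM Hp Hq.
Qed.

Lemma polyfun1_const c : polyfun1 (fun=> c).
Proof. by exists c%:P => t; rewrite hornerC. Qed.

Lemma polyfun1_id : polyfun1 (fun t => t).
Proof. by exists 'X => t; rewrite hornerX. Qed.

Variable k : nat.
Implicit Types (X : set 'A[Omega]_k) (D E : {poly Omega}).

(** The coefficients lie in Omega and not in F, so that curves through arbitrary Omega-points are
    available. The only denominators are powers of D. *)
Definition rational_curve D (gam : Omega -> 'A[Omega]_k) : Prop :=
  forall i, loc_on [set t | D.[t] != 0] (horner D) polyfun1 (fun t => gam t i).

Lemma curve_peval D gam p : rational_curve D gam ->
  exists N P, forall t, D.[t] != 0 -> peval iota p (gam t) * D.[t] ^+ N = P.[t].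
Proof.
move=> gamD.
have D1 : polyfun1 (horner D) by exists D.
have [N [g [[P gP] H]]] := fsub_peval (loc_on_subring polyfun1_subring
  [set t | D.[t] != 0] D1) p gamD.
by exists N, P => t Dt; rewrite H.
Qed.

(** Along the curve, and after multiplication by a power of D, a polynomial vanishing on X becomes a
    polynomial in t that is zero at all but finitely many t. An algebraically closed field is
    infinite, so it is zero, in particular at t0. The roots of E are parameters at which the curve
    may leave X. *)
Lemma curve_adherent X D E gam t0 : rational_curve D gam -> E != 0 ->
  (forall t, D.[t] != 0 -> E.[t] != 0 -> X (gam t)) -> D.[t0] != 0 ->
  zclosure iota X (gam t0).
Proof.
move=> gamD E0 gamX Dt0 p pX.
have [N [P HP]] := curve_peval p gamD.
have D0 : D != 0 by apply: contra_neq Dt0 => ->; rewrite horner0.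
have P0 : P = 0.
  apply/eqP/negPn/negP => P0.
  have /closed_nonrootP[t] : D * E * P != 0 by rewrite !mulf_neq0.
  rewrite /root !hornerM !mulf_eq0 !negb_or => /andP[/andP[Dt Et]].
  by rewrite -HP // pX ?mul0r ?eqxx //; apply: gamX.
by have /eqP := HP t0 Dt0; rewrite P0 horner0 mulf_eq0 expf_eq0 (negPf Dt0)
  andbF orbF => /eqP.
Qed.

(** If X were covered by Y and Z but contained in neither, an equation p of Y would be nonzero at
    some x and an equation q of Z at some y. On a curve through x and y both restrict to nonzero
    polynomials in t, so some point of the curve in X avoids both Y and Z. *)
Lemma curves_irreducible X : X !=set0 ->
  (forall x y, X x -> X y -> exists D E gam t0 t1,
    [/\ rational_curve D gam, E != 0,
        forall t, D.[t] != 0 -> E.[t] != 0 -> X (gam t),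
        D.[t0] != 0 /\ gam t0 = x & D.[t1] != 0 /\ gam t1 = y]) ->
  zirreducible iota X.
Proof.
move=> X0 conn; split=> // Y Z [I ->] [J ->] XYZ.
apply: contrapT => /not_orP[/existsNP[x /not_implyP[Xx]] /existsNP[p]].
move=> /not_implyP[Ip /eqP px] /existsNP[y /not_implyP[Xy]] /existsNP[q].
move=> /not_implyP[Jq /eqP qy].
have [D [E [gam [t0 [t1 [gamD E0 gamX [Dt0 gt0] [Dt1 gt1]]]]]]] := conn x y Xx Xy.
have [N [P HP]] := curve_peval p gamD.
have [M [Q HQ]] := curve_peval q gamD.
have D0 : D != 0 by apply: contra_neq Dt0 => ->; rewrite horner0.
have P0 : P != 0.
  apply: contra_neq px => P0; have /eqP := HP t0 Dt0.
  by rewrite P0 horner0 gt0 mulf_eq0 expf_eq0 (negPf Dt0) andbF orbF => /eqP.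
have Q0 : Q != 0.
  apply: contra_neq qy => Q0; have /eqP := HQ t1 Dt1.
  by rewrite Q0 horner0 gt1 mulf_eq0 expf_eq0 (negPf Dt1) andbF orbF => /eqP.
have /closed_nonrootP[t] : D * E * (P * Q) != 0 by rewrite !mulf_neq0.
rewrite /root !hornerM !mulf_eq0 !negb_or => /andP[/andP[Dt Et] /andP[Pt Qt]].
case: (XYZ _ (gamX t Dt Et)) => [/(_ p Ip) pt | /(_ q Jq) qt].
  by move: Pt; rewrite -HP // pt mul0r eqxx.
by move: Qt; rewrite -HQ // qt mul0r eqxx.
Qed.

End RationalCurves.

Arguments polyfun1 {Omega} f.

(** * Bounding chains of irreducible closed sets *)

(* Exponents of monomials in m variables, of degree < D in each variable. *)
Fixpoint box (D m : nat) : finType :=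
  if m is m'.+1 then (box D m' * 'I_D)%type else unit.

Fixpoint box_mon (R : comNzRingType) (D : nat) (h : nat -> R) (m : nat) :
    box D m -> R :=
  if m is m'.+1 return box D m -> R
  then fun al => box_mon h al.1 * h m' ^+ al.2 else fun=> 1.

(* [box_mon] homogenised to degree m * D by means of Q. *)
Fixpoint box_hmon (R : comNzRingType) (D : nat) (H : nat -> R) (Q : R)
    (m : nat) : box D m -> R :=
  if m is m'.+1 return box D m -> R
  then fun al => box_hmon H Q al.1 * (H m' ^+ al.2 * Q ^+ (D - al.2))
  else fun=> 1.

Lemma card_box D m : #|box D m| = (D ^ m)%N.
Proof.
elim: m => [|m IHm] /=; first exact: card_unit.
by rewrite card_prod IHm card_ord expnSr.
Qed.

(** Each variable contributes exactly D factors Q, whatever its exponent, so all monomials acquire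
    the same power of Q and a linear relation survives clearing denominators. *)
Lemma box_hmonE (R : comNzRingType) D (h H : nat -> R) (Q : R) m
    (al : box D m) :
  (forall j, (j < m)%N -> h j * Q = H j) ->
  box_hmon H Q al = box_mon h al * Q ^+ (m * D).
Proof.
elim: m al => [|m IHm] /= al hH; first by rewrite mul0n mulr1.
rewrite IHm => [|j /ltnW]; last exact: hH.
have -> : Q ^+ (m.+1 * D) = Q ^+ (m * D) * (Q ^+ al.2 * Q ^+ (D - al.2)).
  by rewrite -!exprD (subnKC (ltnW (ltn_ord _))) mulSn addnC.
by rewrite -hH // exprMn; ring.
Qed.

Section Counting.
Variables (F : fieldType) (n : nat).
Implicit Types p q : {mpoly F[n]}.

(** Since [msize] is the degree plus one, and 0 at the zero polynomial, a bound [a.+1] says that the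
    degree is at most a and covers the zero polynomial as well. *)
Lemma msizeM_leS p q a b : (msize p <= a.+1)%N -> (msize q <= b.+1)%N ->
  (msize (p * q) <= (a + b).+1)%N.
Proof.
move=> pa qb; have [->|p0] := eqVneq p 0; first by rewrite mul0r msize0.
have [->|q0] := eqVneq q 0; first by rewrite mulr0 msize0.
rewrite msizeM //; apply: (@leq_trans (a.+1 + b.+1).-1); last by rewrite addnS.
by rewrite -!subn1 leq_sub2r // leq_add.
Qed.

Lemma msizeX_leS p a e : (msize p <= a.+1)%N -> (msize (p ^+ e) <= (e * a).+1)%N.
Proof.
move=> pa; elim: e => [|e IHe]; first by rewrite expr0 msize1.
by rewrite exprS mulSn; apply: msizeM_leS.
Qed.

Lemma msize_box_hmon D H Q m (al : box D m) e :
  (forall j, (j < m)%N -> (msize (H j : {mpoly F[n]}) <= e.+1)%N) ->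
  (msize Q <= e.+1)%N ->
  (msize (box_hmon H Q al) <= (m * (D * e)).+1)%N.
Proof.
move=> He Qe; elim: m al He => [|m IHm] /= al He; first by rewrite msize1.
rewrite mulSn addnC; apply: msizeM_leS; first by apply: IHm => j /ltnW; apply: He.
have -> : (D * e = al.2 * e + (D - al.2) * e)%N.
  by rewrite -mulnDl (subnKC (ltnW (ltn_ord _))).
by apply: msizeM_leS; apply: msizeX_leS => //; apply: He.
Qed.

Lemma card_bmultinom B : (#|{: 'X_{1..n < B.+1}}| <= B.+1 ^ n)%N.
Proof.
rewrite -[X in (_ <= X ^ _)%N]card_ord -[X in (_ <= _ ^ X)%N]card_ord -card_ffun.
pose f (m : 'X_{1..n < B.+1}) : {ffun 'I_n -> 'I_B.+1} := [ffun i => inord (m i)].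
apply: (@leq_card _ _ f) => m1 m2 /ffunP E.
have lt_mB (m : 'X_{1..n < B.+1}) i : (m i < B.+1)%N.
  apply: leq_trans (bmdeg m); rewrite ltnS mdegE (bigD1 i) //=; exact: leq_addr.
apply/val_inj/mnmP => i; have := congr1 val (E i).
by rewrite !ffunE /= !inordK.
Qed.

(* D ^ (n + 1) monomials in n + 1 polynomials of degree <= e lie in a space of
   dimension O(D ^ n). *)
Lemma box_hmon_dependent (H : nat -> {mpoly F[n]}) (Q : {mpoly F[n]}) :
  exists D (v : box D n.+1 -> F), (exists al, v al != 0) /\
    \sum_al v al *: box_hmon H Q al = 0.
Proof.
have [e He Qe] : exists2 e,
    forall j, (j < n.+1)%N -> (msize (H j) <= e.+1)%N & (msize Q <= e.+1)%N.
  exists (\sum_(j < n.+1) msize (H j) + msize Q)%N; last first.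
    by rewrite leqW // leq_addl.
  move=> j lt_j; apply/leqW/(leq_trans _ (leq_addr _ _)).
  by rewrite (bigD1 (Ordinal lt_j)) //= leq_addr.
(* All the products have degree at most B, so they lie in a space of dimension at most (B + 1)^n,
   which is at most ((n + 1) e + 1)^n D^n. Taking D larger than the first factor makes this less
   than D^(n + 1), the number of products. *)
pose D := ((n.+1 * e).+1 ^ n).+1%N; pose B := (n.+1 * (D * e))%N.
exists D.
pose M := \matrix_(i < #|box D n.+1|, j < #|{: 'X_{1..n < B.+1}}|)
  (box_hmon H Q (enum_val i))@_(enum_val j).
have ltM : (\rank M < #|box D n.+1|)%N.
  apply: leq_ltn_trans (rank_leq_col M) _; apply: leq_ltn_trans (card_bmultinom B) _.
  rewrite card_box expnS.
  apply: (@leq_ltn_trans ((n.+1 * e).+1 ^ n * D ^ n)%N).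
    have leB : (B.+1 <= (n.+1 * e).+1 * D)%N by rewrite /B /D; nia.
    rewrite -expnMn; case: n leB => [|n'] leB //; by rewrite leq_exp2r.
  by rewrite ltn_mul2r expn_gt0 /= ltnSn.
have /rowV0Pn[v /sub_kermxP vM v0] : kermx M != 0.
  by rewrite kermx_eq0 /row_free neq_ltn ltM.
exists (fun al => v 0 (enum_rank al)); split.
  move: v0 => /rV0Pn[i vi]; exists (enum_val i); by rewrite enum_valK.
apply/mpolyP => m; rewrite mcoeff0 raddf_sum /=.
have [ltm|gem] := ltnP (mdeg m) B.+1; last first.
  apply: big1 => al _; rewrite mcoeffZ memN_msupp_eq0 ?mulr0 //.
  by apply: msize_mdeg_ge; apply: leq_trans gem; apply: msize_box_hmon.
have := congr1 (fun N : 'rV_ _ => N 0 (enum_rank (BMultinom ltm))) vM.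
rewrite !mxE => E; rewrite -[RHS]E.
rewrite (reindex (fun i : 'I_#|box D n.+1| => enum_val i)) /=; last first.
  by apply: onW_bij; apply: enum_val_bij.
by apply: eq_bigr => i _; rewrite mcoeffZ !mxE enum_valK enum_rankK.
Qed.

End Counting.

Section PevalBox.
Variables (F : fieldType) (Omega : closedFieldType).
Variable iota : {rmorphism F -> Omega}.
Variable k : nat.

Lemma peval_box_mon D m (h : nat -> {mpoly F[k]}) (al : box D m) x :
  peval iota (box_mon h al) x = box_mon (fun j => peval iota (h j) x) al.
Proof.
elim: m al => [|m IHm] /= al; first by rewrite -mpolyC1 pevalC rmorph1.
by rewrite pevalM pevalXn IHm.
Qed.

Lemma peval_box_hmon D m (h : nat -> {mpoly F[k]}) Q (al : box D m) x :
  peval iota (box_hmon h Q al) x =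
  box_hmon (fun j => peval iota (h j) x) (peval iota Q x) al.
Proof.
elim: m al => [|m IHm] /= al; first by rewrite -mpolyC1 pevalC rmorph1.
by rewrite !pevalM !pevalXn IHm.
Qed.

End PevalBox.

Section Dimension.
Variables (F : fieldType) (Omega : closedFieldType).
Variable iota : {rmorphism F -> Omega}.
Variable k : nat.
Implicit Types (X : set 'A[Omega]_k) (Z : nat -> set 'A[Omega]_k).

(* If h j vanishes on Z j but not on Z (j + 1), then h 0, ..., h (m - 1) are
   algebraically independent on Z m: in a relation of minimal order in h (m - 1),
   divide by the power of h (m - 1) and restrict to Z (m - 1). *)
Lemma chain_box_mon_free D m Z (h : nat -> {mpoly F[k]}) (v : box D m -> F) :
  (forall i, (i <= m)%N -> zirreducible iota (Z i)) ->
  (forall i, (i < m)%N -> Z i `<=` Z i.+1) ->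
  (forall i, (i < m)%N -> vanishes iota (h i) (Z i) /\
                          ~ vanishes iota (h i) (Z i.+1)) ->
  vanishes iota (\sum_al v al *: box_mon h al) (Z m) ->
  forall al, v al = 0.
Proof.
elim: m v => [|m IHm] v irrZ ZS hZ van.
  have [[x Zx] _] := irrZ 0%N isT.
  have := van x Zx; rewrite (big_pred1 tt) => [|[]//].
  rewrite /= -mul_mpolyC mulr1 pevalC => /eqP; rewrite fmorph_eq0 => /eqP v0.
  by case.
apply: contrapT => /existsNP[[al0 i1] /eqP v_i1].
pose P (i : 'I_D) := [exists al, v (al, i) != 0].
have Pi1 : P i1 by apply/existsP; exists al0.
pose i0 := [arg min_(i < i1 | P i) (i : nat)].
have [Pi0 min_i0] : P i0 /\ forall i : 'I_D, (i < i0)%N -> forall al, v (al, i) = 0.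
  rewrite /i0; case: arg_minnP => // i Pi mini; split=> // j ltji al.
  apply/eqP/negPn/negP => vj; have Pj : P j by apply/existsP; exists al.
  by have := mini j Pj; rewrite leqNgt ltji.
pose q := \sum_(al : box D m.+1) v al *: (box_mon h al.1 * h m ^+ (al.2 - i0)).
have qE : \sum_al v al *: box_mon h al = h m ^+ i0 * q.
  rewrite /q mulr_sumr; apply: eq_bigr => -[al i] _ /=.
  have [lt_i|le_i] := ltnP i i0; first by rewrite min_i0 // !scale0r mulr0.
  by rewrite -[in LHS](subnKC le_i) exprD -scalerAr; congr (_ *: _); ring.
have [hm hm1] := hZ m (leqnn _).
have qZ1 : vanishes iota q (Z m.+1).
  have hq0 x : Z m.+1 x -> peval iota (h m ^+ i0) x * peval iota q x = 0.
    by move=> Zx; rewrite -pevalM -qE van.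
  case: (zirreducible_vanishes (irrZ m.+1 (leqnn _)) hq0) => // hX.
  case: hm1 => x /hX; rewrite pevalXn => /eqP.
  by rewrite expf_eq0 => /andP[_ /eqP].
have {}IH := IHm (fun al => v (al, i0)).
case/existsP: Pi0 => al /negP; apply; apply/eqP; apply: IH => // {al}.
- by move=> i le_i; apply: irrZ; apply: leqW.
- by move=> i lt_i; apply: ZS; apply: leqW.
- by move=> i lt_i; apply: hZ; apply: leqW.
move=> x Zx; rewrite -[RHS](qZ1 x (ZS m (leqnn _) x Zx)) /q.
rewrite (_ : \sum_(al : box D m.+1) _ = \sum_(al : box D m) \sum_(i < D)
   v (al, i) *: (box_mon h al * h m ^+ (i - i0))); last first.
  by rewrite pair_bigA; apply: eq_bigr => -[].
rewrite !peval_sum; apply: eq_bigr => al _.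
rewrite pevalZ peval_sum (bigD1 i0) //= pevalZ subnn expr0 mulr1 big1 ?addr0 // => i ne_i.
have [lt_i|] := ltnP i i0; first by rewrite min_i0 // scale0r peval0.
rewrite leq_eqVlt eq_sym (inj_eq val_inj) (negPf ne_i) /= => lt_i.
rewrite pevalZ pevalM pevalXn hm //.
by rewrite expr0n subn_eq0 leqNgt lt_i !mulr0.
Qed.

Lemma pullback_subring (T : Type) n (u : T -> 'A[Omega]_n) :
  fun_subring iota
    (fun f => exists p : {mpoly F[n]}, forall x, f x = peval iota p (u x)).
Proof.
split=> [c|f g [p Hp] [q Hq]|f g [p Hp] [q Hq]].
- by exists c%:MP => x; rewrite pevalC.
- by exists (p + q) => x; rewrite pevalD Hp Hq.
- by exists (p * q) => x; rewrite pevalM Hp Hq.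
Qed.

(** Functions separating consecutive members of the chain are algebraically independent on the top
    member. But where Q(u) is nonzero they are rational functions of the n functions u, hence
    dependent; by irreducibility the relation extends to the whole top member. *)
Lemma chain_bound n Z (u : 'A[Omega]_k -> 'A[Omega]_n) (Q : {mpoly F[n]}) :
  (forall i, (i <= n.+1)%N -> zirreducible iota (Z i)) ->
  (forall i, (i <= n.+1)%N -> zclosed iota (Z i)) ->
  (forall i, (i < n.+1)%N -> Z i `<` Z i.+1) ->
  (forall j, polyfun iota (fun x => u x j)) ->
  (exists2 x, Z n.+1 x & peval iota Q (u x) != 0) ->
  (forall i, loc_on [set x | Z n.+1 x /\ peval iota Q (u x) != 0]
     (fun x => peval iota Q (u x))
     (fun f => exists p : {mpoly F[n]}, forall x, f x = peval iota p (u x))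
     (fun x => x i)) ->
  False.
Proof.
move=> irrZ clZ ZS polu [x0 Zx0 Qx0] ratx.
pose S (f : 'A[Omega]_k -> Omega) :=
  exists p : {mpoly F[n]}, forall x, f x = peval iota p (u x).
have subS : fun_subring iota S := pullback_subring u.
have SQ : S (fun x => peval iota Q (u x)) by exists Q.
pose E := [set x | Z n.+1 x /\ peval iota Q (u x) != 0].
(* A separating polynomial exists because [Z i] is closed and properly contained in [Z i.+1]. The
   bound on i sits inside the existential so that [choice] applies to all i. *)
have ex_h i : exists h : {mpoly F[k]}, (i < n.+1)%N ->
    vanishes iota h (Z i) /\ ~ vanishes iota h (Z i.+1).
  have [lt_i|] := boolP (i < n.+1)%N; last by exists 0.
  apply: contrapT => /forallNP nh; have [ZiS] := ZS i lt_i; apply.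
  move=> x Zx; rewrite -(zclosed_eq (clZ i (ltnW lt_i))) => p pZ.
  apply: contrapT => px; apply: (nh p) => _; split=> // /(_ x Zx).
  exact: px.
have [h hZ] := choice ex_h.
have ex_H j : exists NH : nat * {mpoly F[n]}, forall x, E x ->
    peval iota (h j) x * peval iota Q (u x) ^+ NH.1 = peval iota NH.2 (u x).
  have [N [g [[p Hp] Hg]]] := fsub_peval (loc_on_subring subS E SQ) (h j) ratx.
  by exists (N, p) => x Ex; rewrite Hg.
have [NH HNH] := choice ex_H.
(* A common exponent: every h j now has denominator Q(u)^N. *)
pose N := (\sum_(j < n.+1) (NH j).1)%N.
have leN j : (j < n.+1)%N -> ((NH j).1 <= N)%N.
  by move=> lt_j; rewrite /N (bigD1 (Ordinal lt_j)) //= leq_addr.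
have [D [v [[al v_al]]]] := box_hmon_dependent
  (fun j => (NH j).2 * Q ^+ (N - (NH j).1)) (Q ^+ N).
move=> /(congr1 (fun p => peval iota p (u _))) dep.
case/eqP: v_al; move: al; apply: (chain_box_mon_free (Z := Z) (h := h)) => //.
  by move=> i lt_i; have [] := ZS i lt_i.
pose R := \sum_al v al *: box_mon h al.
(* Q(u) is rewritten as a polynomial in x, so that it can be cancelled from the relation by
   primality. *)
have [Qu Qu_E] : polyfun iota (fun x => peval iota Q (u x)).
  exact: (fsub_peval (polyfun_subring iota k)).
have RQ x : Z n.+1 x -> peval iota R x * peval iota Qu x = 0.
  move=> Zx; rewrite -Qu_E; have [->|Qx] := eqVneq (peval iota Q (u x)) 0.
    by rewrite mulr0.
  apply/eqP; rewrite mulf_eq0 (negPf Qx) orbF.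
  have := dep x; rewrite peval0 peval_sum => dep_x.
  suff : peval iota R x * (peval iota Q (u x) ^+ N) ^+ (n.+1 * D) = 0.
    by move/eqP; rewrite mulf_eq0 !expf_eq0 (negPf Qx) !andbF orbF.
  rewrite -[RHS]dep_x /R peval_sum mulr_suml; apply: eq_bigr => al _.
  rewrite !pevalZ peval_box_mon peval_box_hmon -mulrA; congr (_ * _).
  rewrite (@box_hmonE _ D (fun j => peval iota (h j) x)) ?pevalXn //.
  move=> j lt_j; rewrite pevalM !pevalXn.
  by rewrite -HNH // -mulrA -exprD subnKC // leN.
have [//|QZ] := zirreducible_vanishes (irrZ _ (leqnn _)) RQ.
by case/eqP: Qx0; rewrite Qu_E QZ.
Qed.

End Dimension.

(** * Products of elementary matrices *)

Section Matrices2.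
Variable R : comNzRingType.
Implicit Types (M : 'M[R]_2) (f g : nat -> R).

Lemma mx2_eta M : M = mx2 (M 0 0) (M 0 1) (M 1 0) (M 1 1).
Proof.
apply/matrixP => i j; rewrite mxE.
by case: i j => [[|[|//]] Hi] [[|[|//]] Hj] /=;
  congr (M _ _); apply: val_inj.
Qed.

Lemma mx2_00 (p q r s : R) : mx2 p q r s 0 0 = p. Proof. by rewrite mxE. Qed.
Lemma mx2_01 (p q r s : R) : mx2 p q r s 0 1 = q. Proof. by rewrite mxE. Qed.
Lemma mx2_10 (p q r s : R) : mx2 p q r s 1 0 = r. Proof. by rewrite mxE. Qed.
Lemma mx2_11 (p q r s : R) : mx2 p q r s 1 1 = s. Proof. by rewrite mxE. Qed.
Definition mx2_entries := (mx2_00, mx2_01, mx2_10, mx2_11).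

Lemma mx2_inj (p q r s p' q' r' s' : R) :
  mx2 p q r s = mx2 p' q' r' s' <-> [/\ p = p', q = q', r = r' & s = s'].
Proof.
split=> [E|[-> -> -> ->] //].
split; [have := congr1 (fun M : 'M_2 => M 0 0) E
       |have := congr1 (fun M : 'M_2 => M 0 1) E
       |have := congr1 (fun M : 'M_2 => M 1 0) E
       |have := congr1 (fun M : 'M_2 => M 1 1) E]; by rewrite !mx2_entries.
Qed.

Lemma mulmx2 (p q r s p' q' r' s' : R) :
  mx2 p q r s * mx2 p' q' r' s' =
  mx2 (p * p' + q * r') (p * q' + q * s') (r * p' + s * r') (r * q' + s * s').
Proof.
rewrite [LHS]mx2_eta; congr mx2; rewrite mxE !big_ord_recl big_ord0 addr0 !mxE //.
Qed.

Lemma one_mx2 : 1 = mx2 1 0 0 1 :> 'M[R]_2.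
Proof. by rewrite [LHS]mx2_eta !mxE. Qed.

Lemma det_mx2 (p q r s : R) : \det (mx2 p q r s) = p * s - q * r.
Proof.
rewrite (expand_det_row _ 0) !big_ord_recl big_ord0 /cofactor !det_mx11 !mxE /=.
by rewrite addr0 expr0 expr1; ring.
Qed.

(** The adjugate: an inverse for determinant 1 whose entries are visibly polynomial in those of
    M. *)
Definition adj2 M : 'M[R]_2 := mx2 (M 1 1) (- M 0 1) (- M 1 0) (M 0 0).

Lemma mul_adj2 M : \det M = 1 -> M * adj2 M = 1.
Proof.
rewrite {1 2}[M]mx2_eta det_mx2 one_mx2 /adj2 mulmx2 => det1.
by congr mx2; rewrite -?det1; ring.
Qed.

Lemma adj2_mul M : \det M = 1 -> adj2 M * M = 1.
Proof.
rewrite {1 3}[M]mx2_eta det_mx2 one_mx2 /adj2 mulmx2 => det1.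
by congr mx2; rewrite -?det1; ring.
Qed.

Lemma det_adj2 M : \det (adj2 M) = \det M.
Proof. by rewrite {2}[M]mx2_eta !det_mx2; ring. Qed.

Lemma det_elem_factor j (x : R) : \det (elem_factor j x) = 1.
Proof. by rewrite /elem_factor; case: odd; rewrite det_mx2; ring. Qed.

Definition elem_prod s e f : 'M[R]_2 := \prod_(s <= j < e) elem_factor j (f j).

Lemma det_elem_prod s e f : \det (elem_prod s e f) = 1.
Proof.
rewrite /elem_prod; elim/big_ind: _ => [|M N M1 N1|j _].
- exact: det1.
- by rewrite -mulmxE det_mulmx M1 N1 mulr1.
- exact: det_elem_factor.
Qed.

Lemma eq_elem_prod s e f g : (forall j, (s <= j < e)%N -> f j = g j) ->
  elem_prod s e f = elem_prod s e g.
Proof. by move=> fg; apply: eq_big_nat => j /fg ->. Qed.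

Lemma elem_prod_recl s e f : (s < e)%N ->
  elem_prod s e f = elem_factor s (f s) * elem_prod s.+1 e f.
Proof. by move=> lt_se; rewrite /elem_prod big_ltn. Qed.

Lemma elem_prod_geq s e f : (e <= s)%N -> elem_prod s e f = 1.
Proof. by move=> le_es; rewrite /elem_prod big_geq. Qed.

(** For invertible y, the entries y, 1 + yz and 1 + xy determine x, y, z; the formulas of [chart]
    solve these equations. *)
Lemma mulmx2_LUL (x y z : R) :
  Lmx x * (Umx y * Lmx z) =
  mx2 (1 + y * z) y (x + z + x * y * z) (1 + x * y).
Proof. by rewrite !mulmx2; congr mx2; ring. Qed.

(** The degeneration at x_2 = 0: only x_1 + x_3 matters, and x_3 becomes a free parameter. *)
Lemma Lmx_fold (x z : R) : Lmx x * (Umx 0 * Lmx z) = Lmx (x + z).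
Proof. by rewrite !mulmx2; congr mx2; ring. Qed.

End Matrices2.

(* The (i + 1)-st coordinate, extended by 0 beyond the dimension. *)
Definition crd (R : nzRingType) k (x : 'A[R]_k) (i : nat) : R :=
  coord_at x i.+1.

Definition vec (R : nzRingType) k (g : nat -> R) : 'A[R]_k :=
  [ffun i : 'I_k => g i].

Section Coordinates.
Variables (R : nzRingType) (k : nat).

Lemma crd_ord (x : 'A[R]_k) (i : 'I_k) : crd x i = x i.
Proof. by rewrite /crd /coord_at /= valK. Qed.

Lemma coord_crd_fun (T : Type) (gam : T -> 'A[R]_k) (i : 'I_k) :
  (fun t => gam t i) = (fun t => crd (gam t) i).
Proof. by apply/funext => t; rewrite crd_ord. Qed.

Lemma crd_vec (g : nat -> R) i : (i < k)%N -> crd (vec k g) i = g i.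
Proof. by move=> lt_ik; rewrite -[i]/(val (Ordinal lt_ik)) crd_ord ffunE. Qed.

Lemma eq_crd (x y : 'A[R]_k) :
  (forall i, (i < k)%N -> crd x i = crd y i) -> x = y.
Proof. by move=> E; apply/ffunP => i; rewrite -!crd_ord E. Qed.

End Coordinates.

Section Projections.
Variables (R : nzRingType) (k : nat).

Lemma crd_proj_main (x : 'A[R]_k) j :
  (j < k - 3)%N -> crd (proj_main x) j = crd x (j + 3)%N.
Proof.
move=> lt_j; rewrite [LHS](crd_ord _ (Ordinal lt_j)) ffunE /=.
by rewrite /crd -addnS.
Qed.

Lemma crd_proj_other (x : 'A[R]_k) j : (j < k - 3)%N ->
  crd (proj_other x) j = crd x (if j == 0%N then 2 else j + 3)%N.
Proof.
move=> lt_j; rewrite [LHS](crd_ord _ (Ordinal lt_j)) ffunE /=.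
by rewrite /crd; case: eqP; rewrite // -addnS.
Qed.

End Projections.

Section FunctionRingMatrices.
Variables (F : fieldType) (Omega : closedFieldType).
Variable iota : {rmorphism F -> Omega}.
Variables (T : Type) (S : (T -> Omega) -> Prop).
Hypothesis HS : fun_subring iota S.

Lemma fsub_mul_mx (M N : T -> 'M[Omega]_2) :
  (forall i j, S (fun t => M t i j)) -> (forall i j, S (fun t => N t i j)) ->
  forall i j, S (fun t => (M t * N t) i j).
Proof.
move=> SM SN i j; under eq_fun do rewrite mxE.
by apply: (fsub_sum HS) => l; apply: (fsubM HS).
Qed.

Lemma fsub_mx2 (p q r s : T -> Omega) : S p -> S q -> S r -> S s ->
  forall i j, S (fun t => mx2 (p t) (q t) (r t) (s t) i j).
Proof.
move=> Sp Sq Sr Ss i j; under eq_fun do rewrite mxE.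
by case: (i == ord0); case: (j == ord0).
Qed.

Lemma fsub_elem_prod s e (f : nat -> T -> Omega) :
  (forall i, (s <= i < e)%N -> S (f i)) ->
  forall i j, S (fun t => elem_prod s e (fun l => f l t) i j).
Proof.
move=> Sf; rewrite /elem_prod.
elim: e Sf => [|e IHe] Sf.
  move=> i j; under eq_fun do rewrite big_geq // one_mx2.
  by apply: fsub_mx2; do [exact: (fsub0 HS) | exact: (fsub1 HS)].
have [le_se|lt_es] := leqP s e; last first.
  move=> i j; under eq_fun do rewrite big_geq // one_mx2.
  by apply: fsub_mx2; do [exact: (fsub0 HS) | exact: (fsub1 HS)].
move=> i j; under eq_fun do rewrite big_nat_recr //=.
apply: fsub_mul_mx.
  by apply: IHe => l /andP[sl le]; apply: Sf; rewrite sl ltnW.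
have Se : S (f e) by apply: Sf; rewrite le_se /=.
rewrite /elem_factor; case: odd; apply: fsub_mx2 => //;
  do [exact: (fsub0 HS) | exact: (fsub1 HS)].
Qed.

End FunctionRingMatrices.

Lemma polyfun_crd (F : fieldType) (Omega : closedFieldType)
  (iota : {rmorphism F -> Omega}) k i :
  polyfun iota (fun x : 'A[Omega]_k => crd x i).
Proof.
have [lt_i|ge_i] := ltnP i k.
  have E x : crd x i = x (Ordinal lt_i) by rewrite -crd_ord.
  by under eq_fun do rewrite E; apply: polyfun_coord.
have E (x : 'A[Omega]_k) : crd x i = 0.
  by rewrite /crd /coord_at insubF //= ltnNge ge_i.
by under eq_fun do rewrite E; apply: (fsub0 (polyfun_subring iota k)).
Qed.

(** * The part x_2 <> 0 *)

Section Lines.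
Variables (Omega : closedFieldType) (n : nat).

Definition line (w w' : 'A[Omega]_n) (t : Omega) : 'A[Omega]_n :=
  vec n (fun i => crd w i + t * (crd w' i - crd w i)).

Lemma line0 w w' : line w w' 0 = w.
Proof. by apply: eq_crd => i lt_i; rewrite crd_vec // mul0r addr0. Qed.

Lemma line1 w w' : line w w' 1 = w'.
Proof. by apply: eq_crd => i lt_i; rewrite crd_vec // mul1r addrC subrK. Qed.

Lemma polyfun1_line w w' i : polyfun1 (fun t => crd (line w w' t) i).
Proof.
have [lt_i|ge_i] := ltnP i n.
  under eq_fun do rewrite crd_vec //.
  exists ((crd w i)%:P + 'X * (crd w' i - crd w i)%:P) => t.
  by rewrite hornerD hornerM hornerX !hornerC.
have E (x : 'A[Omega]_n) : crd x i = 0.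
  by rewrite /crd /coord_at insubF //= ltnNge ge_i.
by under eq_fun do rewrite E; apply: polyfun1_const.
Qed.

End Lines.

Section Variety.
Variables (F : fieldType) (Omega : closedFieldType).
Variable iota : {rmorphism F -> Omega}.
Variable k : nat.
Variables a b c d : F.
Hypothesis det1 : a * d - c * b = 1.

Local Notation A := (mx2 a c b d).
Local Notation V := (Vk iota k A).
Implicit Types (x : 'A[Omega]_k) (f g : nat -> Omega).

Lemma map_A : map_mx iota A = mx2 (iota a) (iota c) (iota b) (iota d).
Proof. by rewrite [LHS]mx2_eta !mxE. Qed.

Lemma det_map_A : \det (map_mx iota A) = 1.
Proof. by rewrite det_map_mx det_mx2 det1 rmorph1. Qed.

(** What the first s factors must multiply to, once the last k - s coordinates are given. It depends
    on those last coordinates only, which turns the equations of V into a formula for the first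
    s. *)
Definition residual s f : 'M[Omega]_2 := map_mx iota A * adj2 (elem_prod s k f).

Lemma eq_residual s f g : (forall j, (s <= j < k)%N -> f j = g j) ->
  residual s f = residual s g.
Proof. by move=> fg; rewrite /residual (eq_elem_prod fg). Qed.

Lemma det_residual s f :
  residual s f 0 0 * residual s f 1 1 - residual s f 0 1 * residual s f 1 0 = 1.
Proof.
by rewrite -det_mx2 -mx2_eta /residual -mulmxE det_mulmx det_map_A det_adj2 det_elem_prod
  mulr1.
Qed.

Lemma VkE x : V x <-> map_mx iota A = elem_prod 0 k (crd x).
Proof.
rewrite /Vk /= /elem_prod big_mkord.
by under [X in _ <-> _ = X]eq_bigr do rewrite crd_ord.
Qed.

Lemma Vk_residual s x : (s <= k)%N ->
  V x <-> residual s (crd x) = elem_prod 0 s (crd x).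
Proof.
move=> le_sk; rewrite VkE /residual.
have -> : elem_prod 0 k (crd x) = elem_prod 0 s (crd x) * elem_prod s k (crd x).
  by rewrite /elem_prod -big_cat_nat.
split=> [->|E]; first by rewrite -mulrA mul_adj2 ?mulr1 ?det_elem_prod.
by rewrite -E -mulrA adj2_mul ?mulr1 ?det_elem_prod.
Qed.

Lemma elem_prod03 f : elem_prod 0 3 f =
  mx2 (1 + f 1%N * f 2%N) (f 1%N) (f 0%N + f 2%N + f 0%N * f 1%N * f 2%N)
      (1 + f 0%N * f 1%N).
Proof.
by rewrite 3?elem_prod_recl // elem_prod_geq // mulr1 -mulmx2_LUL.
Qed.

(** With x_2 = 0 the first three factors fold into one, so this is the three-factor formula in x_1 +
    x_3, x_4, x_5. *)
Lemma elem_prod05 f : f 1%N = 0 -> elem_prod 0 5 f =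
  mx2 (1 + f 3%N * f 4%N) (f 3%N)
      (f 0%N + f 2%N + f 4%N + (f 0%N + f 2%N) * f 3%N * f 4%N)
      (1 + (f 0%N + f 2%N) * f 3%N).
Proof.
move=> f1; rewrite 5?elem_prod_recl // elem_prod_geq // mulr1 -mulmx2_LUL.
by rewrite -Lmx_fold -[in RHS]f1 !mulrA.
Qed.

Lemma elem_prod04 f : f 1%N = 0 -> elem_prod 0 4 f =
  mx2 1 (f 3%N) (f 0%N + f 2%N) (1 + (f 0%N + f 2%N) * f 3%N).
Proof.
move=> f1; rewrite 4?elem_prod_recl // elem_prod_geq // mulr1.
have -> : elem_factor 3 (f 3%N) = Umx (f 3%N) by [].
rewrite [elem_factor 2 _ * _](_ : _ = Lmx (f 2%N) * Umx (f 3%N)) //.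
rewrite /elem_factor /= f1 mulrA mulrA -[Lmx _ * _ * _]mulrA Lmx_fold mulmx2.
by congr mx2; ring.
Qed.

Lemma Vk_eqs3 x : (3 <= k)%N -> V x <->
  [/\ residual 3 (crd x) 0 0 = 1 + crd x 1 * crd x 2,
      residual 3 (crd x) 0 1 = crd x 1,
      residual 3 (crd x) 1 0 = crd x 0 + crd x 2 + crd x 0 * crd x 1 * crd x 2 &
      residual 3 (crd x) 1 1 = 1 + crd x 0 * crd x 1].
Proof.
by move=> k3; rewrite (Vk_residual _ k3) elem_prod03 {1}[residual _ _]mx2_eta mx2_inj.
Qed.

Lemma Vk_eqs5 x : (5 <= k)%N -> crd x 1 = 0 -> V x <->
  [/\ residual 5 (crd x) 0 0 = 1 + crd x 3 * crd x 4,
      residual 5 (crd x) 0 1 = crd x 3,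
      residual 5 (crd x) 1 0 = crd x 0 + crd x 2 + crd x 4 +
                               (crd x 0 + crd x 2) * crd x 3 * crd x 4 &
      residual 5 (crd x) 1 1 = 1 + (crd x 0 + crd x 2) * crd x 3].
Proof.
move=> k5 x1.
by rewrite (Vk_residual _ k5) elem_prod05 // {1}[residual _ _]mx2_eta mx2_inj.
Qed.

Lemma zclosed_Vk : zclosed iota V.
Proof.
have polyV i j : polyfun iota (fun x => elem_prod 0 k (crd x) i j).
  apply: (fsub_elem_prod (polyfun_subring iota k)) => l _; exact: polyfun_crd.
have polyA i j : polyfun iota (fun x : 'A[Omega]_k => map_mx iota A i j).
  by under eq_fun do rewrite mxE; apply: (fsub_const (polyfun_subring iota k)).
pose C i j := [set x : 'A[Omega]_k | map_mx iota A i j = elem_prod 0 k (crd x) i j].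
have -> : V = C 0 0 `&` C 0 1 `&` (C 1 0 `&` C 1 1).
  apply/seteqP; split=> x; first by move/VkE=> E; rewrite /C /= E.
  move=> [[E1 E2] [E3 E4]]; apply/VkE.
  by rewrite [LHS]mx2_eta [RHS]mx2_eta; congr mx2.
by do !apply: zclosedI; apply: zclosed_polyfun_eq.
Qed.

Section SubringResidual.
Variables (T : Type) (S : (T -> Omega) -> Prop).
Hypothesis HS : fun_subring iota S.

Lemma fsub_residual s (f : nat -> T -> Omega) :
  (forall j, (s <= j < k)%N -> S (f j)) ->
  forall i j, S (fun t => residual s (fun l => f l t) i j).
Proof.
move=> Sf; apply: (fsub_mul_mx HS).
  by move=> i j; under eq_fun do rewrite mxE; apply: (fsub_const HS).
have SP := fsub_elem_prod HS Sf.
by rewrite /adj2; apply: fsub_mx2 => //; apply: (fsubN HS).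
Qed.

End SubringResidual.

Hypothesis k_ge3 : (3 <= k)%N.

(** The truncated subtraction gives meaningless values for j < 3, which [residual 3] does not
    read. *)
Definition res_of (w : 'A[Omega]_(k - 3)) : 'M[Omega]_2 :=
  residual 3 (fun j => crd w (j - 3)).

Lemma res_of_proj_main x : res_of (proj_main x) = residual 3 (crd x).
Proof.
apply: eq_residual => j /andP[le3j ltjk].
by rewrite crd_proj_main ?subnK // ltn_sub2r // (leq_ltn_trans le3j).
Qed.

(* The inverse of (x_1, ..., x_k) |-> (x_4, ..., x_k) on the part x_2 <> 0. *)
Definition chart (w : 'A[Omega]_(k - 3)) : 'A[Omega]_k :=
  vec k (fun i => if i == 0%N then (res_of w 1 1 - 1) / res_of w 0 1
                  else if i == 1%N then res_of w 0 1
                  else if i == 2%N then (res_of w 0 0 - 1) / res_of w 0 1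
                  else crd w (i - 3)).

Definition chart_dom : set 'A[Omega]_(k - 3) := [set w | res_of w 0 1 != 0].

Definition main_part : set 'A[Omega]_k := V `&` [set x | crd x 1 != 0].

Lemma crd_chart w i : (i < k)%N -> crd (chart w) i =
  if i == 0%N then (res_of w 1 1 - 1) / res_of w 0 1
  else if i == 1%N then res_of w 0 1
  else if i == 2%N then (res_of w 0 0 - 1) / res_of w 0 1 else crd w (i - 3).
Proof. exact: crd_vec. Qed.

Lemma proj_main_chart w : proj_main (chart w) = w.
Proof.
apply: eq_crd => i lt_i; rewrite crd_proj_main // crd_chart; last by lia.
by rewrite !addn3 /= !subSS subn0.
Qed.

Lemma chart_main_part w : chart_dom w -> main_part (chart w).
Proof.
rewrite /chart_dom /= => q0.
have E i : (i < 3)%N -> (i < k)%N by move=> /leq_trans; apply.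
have E1 : crd (chart w) 1 = res_of w 0 1 by rewrite crd_chart ?E.
split; last by rewrite /= E1.
apply/Vk_eqs3 => //; rewrite -res_of_proj_main proj_main_chart E1 !crd_chart ?E //=.
have := det_residual 3 (fun j => crd w (j - 3)); rewrite -/(res_of w) => det_w.
(* The chart solves three of the four entry equations; the lower left one follows from determinant
   1. *)
have -> : res_of w 1 0 = (res_of w 0 0 * res_of w 1 1 - 1) / res_of w 0 1.
  by rewrite -[X in _ - X]det_w; field.
by split=> //; field.
Qed.

Lemma main_part_proj x : main_part x ->
  chart_dom (proj_main x) /\ chart (proj_main x) = x.
Proof.
move=> [/Vk_eqs3 -/(_ k_ge3) [E00 E01 _ E11] /= x1].
rewrite /chart_dom /= res_of_proj_main E01; split=> //.
apply: eq_crd => i lt_ik; rewrite crd_chart // res_of_proj_main E00 E01 E11.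
case: i lt_ik => [|[|[|i]]] lt_ik //=; rewrite ?[1 + _]addrC ?addrK.
- by rewrite mulfK.
- by rewrite mulrAC mulfV // mul1r.
- by rewrite crd_proj_main; [congr crd; lia | lia].
Qed.

Lemma polyfun_res_of i j : polyfun iota (fun w => res_of w i j).
Proof.
apply: (fsub_residual (polyfun_subring iota _)) => l _; exact: polyfun_crd.
Qed.

Lemma polyfun1_res_line w w' i j : polyfun1 (fun t => res_of (line w w' t) i j).
Proof.
by apply: (fsub_residual (polyfun1_subring iota)) => l _; apply: polyfun1_line.
Qed.

Lemma chart_line_curve w w' (D : {poly Omega}) :
  (forall t, res_of (line w w' t) 0 1 = D.[t]) ->
  rational_curve D (fun t => chart (line w w' t)).
Proof.
move=> DE i.
have HS := polyfun1_subring iota.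
have loc (f : Omega -> Omega) : polyfun1 f ->
    loc_on [set t | D.[t] != 0] (horner D) polyfun1 f.
  exact: loc_on_base.
have locV (f : Omega -> Omega) : polyfun1 f ->
    loc_on [set t | D.[t] != 0] (horner D) polyfun1 (fun t => f t / D.[t]).
  by apply: loc_on_div.
have res1 j l : polyfun1 (fun t => res_of (line w w' t) j l - 1).
  apply: (fsubB HS); [exact: polyfun1_res_line | exact: polyfun1_const].
rewrite (_ : (fun t => _) = (fun t =>
  if i == 0%N :> nat then (res_of (line w w' t) 1 1 - 1) / D.[t]
  else if i == 1%N :> nat then D.[t]
  else if i == 2%N :> nat then (res_of (line w w' t) 0 0 - 1) / D.[t]
  else crd (line w w' t) (i - 3))); last first.
  by apply/funext => t; rewrite ffunE DE.
case: (nat_of_ord i) => [|[|[|n]]] /=.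
- exact: locV.
- by apply: loc; exists D.
- exact: locV.
- by apply: loc; apply: polyfun1_line.
Qed.

(** The chart turns a line of L into a rational curve whose denominator is the entry [res_of w 0 1]
    along that line. It serves with L the whole space, for V itself, and with coordinate flats, for
    the chain that bounds the dimension from below. *)
Lemma chart_image_irreducible (L : set 'A[Omega]_(k - 3)) :
  (forall w w' t, L w -> L w' -> L (line w w' t)) -> (L `&` chart_dom) !=set0 ->
  zirreducible iota (chart @` (L `&` chart_dom)).
Proof.
move=> linL [w0 Lw0]; apply: (curves_irreducible iota).
  by exists (chart w0), w0.
move=> _ _ [w [Lw qw] <-] [w' [Lw' qw'] <-].
have [D DE] := polyfun1_res_line w w' 0 1.
exists D, 1, (fun t => chart (line w w' t)), 0, 1; split.
- exact: chart_line_curve.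
- exact: oner_neq0.
- move=> t Dt _; exists (line w w' t) => //; split; first exact: linL.
  by rewrite /chart_dom /= DE.
- by rewrite -DE line0.
- by rewrite -DE line1.
Qed.

Lemma chart_dom_open : zopen_in iota setT chart_dom.
Proof.
have [q qE] := polyfun_res_of 0 1.
exists [set w | peval iota q w = 0]; split; first exact: zclosed_zeros.
apply/seteqP; split=> w; rewrite /chart_dom /= qE; first by move=> /eqP.
by move=> [_ /eqP].
Qed.

Lemma main_part_open : zopen_in iota V main_part.
Proof.
have [q qE] := polyfun_crd iota k 1.
exists [set x | peval iota q x = 0]; split; first exact: zclosed_zeros.
apply/seteqP; split=> x [Vx /=].
  by rewrite qE => /eqP x1; split.
by move=> /eqP x1; split=> //=; rewrite qE.
Qed.

Lemma main_part_chart : main_part = chart @` chart_dom.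
Proof.
apply/seteqP; split=> [x /main_part_proj[Wx <-]|_ [w Ww <-]].
  by exists (proj_main x).
exact: chart_main_part.
Qed.

Lemma sub_main_part : main_part `<=` V. Proof. by move=> x []. Qed.

Hypothesis k3_c : ~ (k = 3%N /\ c = 0).

(** A point with coordinates in F, so that fixing a coordinate at its value there is an equation
    over F. *)
Definition base_pt (t : F) : 'A[Omega]_(k - 3) :=
  vec (k - 3) (fun i => if i == 0%N then iota t else 0).

Lemma res_of_base_pt t : (3 < k)%N ->
  res_of (base_pt t) 0 1 = iota c - iota a * iota t.
Proof.
move=> k4; rewrite /res_of /residual elem_prod_recl //.
have -> : elem_prod 4 k (fun j => crd (base_pt t) (j - 3)) = 1.
  rewrite /elem_prod big_nat big1 // => j /andP[le4j ltjk].
  rewrite crd_vec; last by lia.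
  rewrite ifN; last by lia.
  by rewrite /elem_factor one_mx2; case: odd.
rewrite mulr1 /elem_factor /= crd_vec; last by lia.
by rewrite /= map_A /adj2 !mx2_entries mulmx2 mx2_entries; ring.
Qed.

(** The relevant entry is c if k = 3 and c - a t if k > 3. Since a and c are not both 0, one of t =
    0 and t = 1 makes the latter nonzero. *)
Lemma exists_base_pt : exists t, chart_dom (base_pt t).
Proof.
have [k4|] := ltnP 3 k; last first.
  move=> le_k3; exists 0.
  have k3 : k = 3 by apply/eqP; rewrite eqn_leq le_k3.
  have c0 : c != 0 by apply/eqP => c0; apply: k3_c.
  rewrite /chart_dom /= /res_of /residual elem_prod_geq ?k3 // map_A one_mx2.
  rewrite /adj2 !mx2_entries mulmx2 mx2_entries oppr0 mulr0 add0r mulr1.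
  by rewrite fmorph_eq0.
have [c0|c0] := eqVneq c 0.
  exists 1; rewrite /chart_dom /= res_of_base_pt // c0 rmorph0 rmorph1 mulr1 sub0r.
  rewrite oppr_eq0 fmorph_eq0; apply/eqP => a0.
  by move: det1; rewrite a0 c0 !mul0r subrr => /eqP; rewrite eq_sym oner_eq0.
by exists 0; rewrite /chart_dom /= res_of_base_pt // rmorph0 mulr0 subr0 fmorph_eq0.
Qed.

Lemma main_part_irreducible : zirreducible iota main_part.
Proof.
rewrite main_part_chart -[chart_dom]setTI; apply: chart_image_irreducible => //.
by have [t Ht] := exists_base_pt; exists (base_pt t).
Qed.

Lemma chart_dom_dense : zdense_in iota setT chart_dom.
Proof.
apply: zdense_in_closure => // w _; have [t Ht] := exists_base_pt.
have [E EE] := polyfun1_res_line w (base_pt t) 0 1.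
rewrite -(line0 w (base_pt t)).
apply: (@curve_adherent _ _ _ _ _ 1 E (line w (base_pt t))).
- move=> i; apply: loc_on_base.
  by under eq_fun do rewrite -crd_ord; apply: polyfun1_line.
- apply: contraTneq Ht => E0.
  by rewrite /chart_dom /= -(line1 w (base_pt t)) EE E0 horner0 eqxx.
- by move=> s _ Es; rewrite /chart_dom /= EE.
- by rewrite hornerC oner_neq0.
Qed.

End Variety.

(** * Dimension *)

Section DimensionVk.
Variables (F : fieldType) (Omega : closedFieldType).
Variable iota : {rmorphism F -> Omega}.
Variable k : nat.
Variables a b c d : F.
Hypothesis det1 : a * d - c * b = 1.
Hypothesis k_ge3 : (3 <= k)%N.
Hypothesis k3_c : ~ (k = 3%N /\ c = 0).

Local Notation A := (mx2 a c b d).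
Local Notation V := (Vk iota k A).
Implicit Types (x : 'A[Omega]_k) (Z : set 'A[Omega]_k).

Section PieceBound.
Variables (Zs : nat -> set 'A[Omega]_k).
Local Notation Z := (Zs (k - 3).+1).
Hypothesis irrZ : forall i, (i <= (k - 3).+1)%N -> zirreducible iota (Zs i).
Hypothesis clZ : forall i, (i <= (k - 3).+1)%N -> zclosed iota (Zs i).
Hypothesis ltZ : forall i, (i < (k - 3).+1)%N -> Zs i `<` Zs i.+1.
Hypothesis ZV : Z `<=` V.

(** The parameters are x_4, ..., x_k and the denominator is x_2, which on V is itself a polynomial
    in them. *)
Lemma no_chain_main : (exists2 x, Z x & crd x 1 != 0) -> False.
Proof.
move=> [x0 Zx0 x01]; pose u := @proj_main Omega k.
have [Q QE] := polyfun_res_of iota k a b c d 0 1.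
have eqs x : Z x -> _ := fun Zx => (Vk_eqs3 iota a b c d x k_ge3).1 (ZV Zx).
have QZ x : Z x -> peval iota Q (u x) = crd x 1.
  by move=> Zx; rewrite -QE res_of_proj_main //; case: (eqs x Zx).
have Sres i j : exists p, forall x, res_of iota a b c d (u x) i j - 1 =
    peval iota p (u x).
  have [p Hp] := polyfun_res_of iota k a b c d i j.
  by exists (p - 1) => x; rewrite pevalD pevalN Hp -mpolyC1 pevalC rmorph1.
apply: (chain_bound (u := u) (Q := Q) irrZ clZ ltZ).
- by move=> j; under eq_fun do rewrite ffunE; apply: polyfun_crd.
- by exists x0; rewrite ?QZ.
move=> i; rewrite (coord_crd_fun id).
case: i => [[|[|[|i]]] lt_i] /=.
- exists 1%N, (fun x => res_of iota a b c d (u x) 1 1 - 1); split=> //.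
  move=> x [Zx _]; rewrite QZ // expr1 res_of_proj_main //.
  by case: (eqs x Zx) => _ _ _ ->; ring.
- exists 0%N, (fun x => peval iota Q (u x)); split; first by exists Q.
  by move=> x [Zx _]; rewrite QZ // mulr1.
- exists 1%N, (fun x => res_of iota a b c d (u x) 0 0 - 1); split=> //.
  move=> x [Zx _]; rewrite QZ // expr1 res_of_proj_main //.
  by case: (eqs x Zx) => -> _ _ _; ring.
- apply: loc_on_base; have [p Hp] := @polyfun_crd _ _ iota (k - 3) i.
  exists p => x; rewrite -Hp crd_proj_main; last by lia.
  by rewrite addn3.
Qed.

(** Here x_4 = c and x_1 = b - x_3, so x_3 is the only parameter and no denominator occurs. *)
Lemma no_chain_other4 : k = 4%N -> (forall x, Z x -> crd x 1 = 0) -> False.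
Proof.
move=> k4 Zx1; pose u := @proj_other Omega k.
have k4' : (4 <= k)%N by rewrite k4.
have eqs x : Z x -> iota a = 1 /\ iota c = crd x 3 /\
    iota b = crd x 0 + crd x 2.
  move=> Zx; have := (Vk_residual iota a b c d x k4').1 (ZV Zx).
  rewrite elem_prod04 ?Zx1 // /residual elem_prod_geq ?k4 //.
  rewrite map_A /adj2 one_mx2 !mx2_entries mulmx2 mx2_inj => -[].
  rewrite ?oppr0 ?mulr0 ?mulr1 ?addr0 ?add0r; by split.
have u0 x : crd (u x) 0 = crd x 2 by rewrite crd_proj_other // k4.
apply: (chain_bound (u := u) (Q := 1) irrZ clZ ltZ).
- by move=> j; under eq_fun do rewrite ffunE; apply: polyfun_crd.
- have [[x Zx] _] := irrZ (leqnn _).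
  by exists x; rewrite // -mpolyC1 pevalC rmorph1 oner_eq0.
have subS := @pullback_subring _ _ iota _ _ u.
have SC := fsub_const subS.
have Su j : exists p, forall x, crd (u x) j = peval iota p (u x).
  by have [p Hp] := @polyfun_crd _ _ iota (k - 3) j; exists p => x; rewrite -Hp.
have loc (f g : 'A[Omega]_k -> Omega) :
    (exists p, forall x, g x = peval iota p (u x)) ->
    (forall x, Z x -> f x = g x) ->
    loc_on [set x | Z x /\ peval iota (1 : {mpoly F[k - 3]}) (u x) != 0]
     (fun x => peval iota (1 : {mpoly F[k - 3]}) (u x))
     (fun f => exists p : {mpoly F[k - 3]}, forall x, f x = peval iota p (u x)) f.
  by move=> Sg fg; exists 0%N, g; split=> // x [Zx _]; rewrite mulr1 fg.
move=> i; rewrite (coord_crd_fun id).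
have : (i < 4)%N by rewrite -k4.
case: (nat_of_ord i) => [|[|[|[|//]]]] _.
- apply: (loc _ (fun x => iota b - crd (u x) 0)); first exact: (fsubB subS).
  by move=> x /eqs[_ [_ ->]]; rewrite u0 addrK.
- by apply: (loc _ (fun x => iota 0)) => // x /Zx1; rewrite rmorph0.
- exact: (loc _ (fun x => crd (u x) 0)).
- by apply: (loc _ (fun x => iota c)) => // x /eqs[_ [->]].
Qed.

(** The first five factors act as three, in x_1 + x_3, x_4, x_5, and the parameters are x_3, x_5,
    ..., x_k. If x_4 vanishes on Z, the lower left entry gives x_1 as a polynomial in them.
    Otherwise x_4 takes over the role of x_2 as denominator. *)
Lemma no_chain_other5 : (5 <= k)%N -> (forall x, Z x -> crd x 1 = 0) -> False.
Proof.
move=> k5 Zx1; pose u := @proj_other Omega k.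
have eqs x : Z x -> _ :=
  fun Zx => (Vk_eqs5 iota a b c d k5 (Zx1 x Zx)).1 (ZV Zx).
have polyu j : polyfun iota (fun x => u x j).
  by under eq_fun do rewrite ffunE; apply: polyfun_crd.
have u0 x : crd (u x) 0 = crd x 2 by rewrite crd_proj_other //; lia.
have uS x j : (j < k)%N -> (4 <= j)%N -> crd (u x) (j - 3) = crd x j.
  move=> lt_j le_j; rewrite crd_proj_other; last by lia.
  by rewrite ifN; [congr crd; lia | lia].
have subS := @pullback_subring _ _ iota _ _ u.
pose S := fun f : 'A[Omega]_k -> Omega =>
  exists p : {mpoly F[k - 3]}, forall x, f x = peval iota p (u x).
have Su j : S (fun x => crd (u x) j).
  by have [p Hp] := @polyfun_crd _ _ iota (k - 3) j; exists p => x; rewrite -Hp.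
pose R x := residual iota k a b c d 5 (fun j => crd (u x) (j - 3)).
have RE x : R x = residual iota k a b c d 5 (crd x).
  by apply: eq_residual => j /andP[le5j ltjk]; rewrite uS // ltnW.
have SR i j : S (fun x => R x i j).
  move: i j; apply: (fsub_residual (k := k) a b c d subS (s := 5)
    (f := fun j x => crd (u x) (j - 3))) => j _.
  exact: Su.
have S1 := fsub1 subS.
have [Zx3|/existsNP[x0 /not_implyP[Zx0 /eqP x03]]] :=
  EM (forall x, Z x -> crd x 3 = 0).
- apply: (chain_bound (u := u) (Q := 1) irrZ clZ ltZ) => //.
    have [[x Zx] _] := irrZ (leqnn _).
    by exists x; rewrite // -mpolyC1 pevalC rmorph1 oner_eq0.
  have loc (f g : 'A[Omega]_k -> Omega) : S g -> (forall x, Z x -> f x = g x) ->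
    loc_on [set x | Z x /\ peval iota (1 : {mpoly F[k - 3]}) (u x) != 0]
       (fun x => peval iota (1 : {mpoly F[k - 3]}) (u x)) S f.
    by move=> Sg fg; exists 0%N, g; split=> // x [Zx _]; rewrite mulr1 fg.
  move=> i; rewrite (coord_crd_fun id).
  have lt_i := ltn_ord i; move: (nat_of_ord i) lt_i => {}i lt_i.
  have [le4i|] := leqP 4 i.
    by apply: (loc _ (fun x => crd (u x) (i - 3))) => // x _; rewrite uS.
  case: i lt_i => [|[|[|[|//]]]] _ _.
  + apply: (loc _ (fun x => R x 1 0 - crd (u x) 0 - crd (u x) 1)).
      apply: (fsubB subS (f := fun x => _ - _)); last exact: Su.
      by apply: (fsubB subS); [exact: SR | exact: Su].
    move=> x Zx; rewrite RE u0 -[1%N]/((4 - 3)%N) uS //.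
    by case: (eqs x Zx) => _ _ -> _; rewrite Zx3 //; ring.
  + by apply: (loc _ (fun x => 0)) => //; apply: (fsub0 subS).
  + exact: (loc _ (fun x => crd (u x) 0)).
  + by apply: (loc _ (fun x => 0)) => //; apply: (fsub0 subS).
- have [Q QE] := SR 0 1.
  have QZ x : Z x -> peval iota Q (u x) = crd x 3.
    by move=> Zx; rewrite -QE RE; case: (eqs x Zx).
  apply: (chain_bound (u := u) (Q := Q) irrZ clZ ltZ) => //.
    by exists x0; rewrite ?QZ.
  have loc (f g : 'A[Omega]_k -> Omega) :
      S g -> (forall x, Z x -> f x * crd x 3 = g x) ->
      loc_on [set x | Z x /\ peval iota Q (u x) != 0]
       (fun x => peval iota Q (u x)) S f.
    by move=> Sg fg; exists 1%N, g; split=> // x [Zx _]; rewrite expr1 QZ // fg.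
  move=> i; rewrite (coord_crd_fun id).
  have lt_i := ltn_ord i; move: (nat_of_ord i) lt_i => {}i lt_i.
  have [le5i|] := leqP 5 i.
    apply: (loc _ (fun x => crd (u x) (i - 3) * R x 0 1)).
      by apply: (fsubM subS); [exact: Su | exact: SR].
    move=> x Zx; rewrite uS // ?(ltnW le5i) //.
    by rewrite RE; case: (eqs x Zx) => _ -> _ _.
  case: i lt_i => [|[|[|[|[|//]]]]] _ _.
  + apply: (loc _ (fun x => R x 1 1 - 1 - crd (u x) 0 * R x 0 1)).
      apply: (fsubB subS (f := fun x => _ - _)).
        by apply: (fsubB subS); [exact: SR | exact: S1].
      by apply: (fsubM subS); [exact: Su | exact: SR].
    move=> x Zx; rewrite RE u0.
    by case: (eqs x Zx) => _ -> _ ->; ring.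
  + apply: (loc _ (fun x => 0)); first exact: (fsub0 subS).
    by move=> x Zx; rewrite Zx1 ?mul0r.
  + apply: (loc _ (fun x => crd (u x) 0 * R x 0 1)).
      by apply: (fsubM subS); [exact: Su | exact: SR].
    by move=> x Zx; rewrite u0 RE; case: (eqs x Zx) => _ -> _ _.
  + apply: (loc _ (fun x => R x 0 1 * R x 0 1)).
      by apply: (fsubM subS); exact: SR.
    by move=> x Zx; rewrite RE; case: (eqs x Zx) => _ -> _ _.
  + apply: (loc _ (fun x => R x 0 0 - 1)).
      by apply: (fsubB subS); [exact: SR | exact: S1].
    by move=> x Zx; rewrite RE; case: (eqs x Zx) => -> _ _ _; ring.
Qed.

End PieceBound.

Lemma Vk_chain_bound l (Zs : nat -> set 'A[Omega]_k) :
  irreducible_chain iota V l Zs -> (l <= k - 3)%N.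
Proof.
move=> [HZ ltZ]; rewrite leqNgt; apply/negP => lt_l.
have irrZ i : (i <= (k - 3).+1)%N -> zirreducible iota (Zs i).
  by move=> le_i; have [] := HZ i (leq_trans le_i lt_l).
have clZ i : (i <= (k - 3).+1)%N -> zclosed iota (Zs i).
  by move=> le_i; have [] := HZ i (leq_trans le_i lt_l).
have {}ltZ i : (i < (k - 3).+1)%N -> Zs i `<` Zs i.+1.
  by move=> lt_i; apply/ltZ/(leq_trans lt_i lt_l).
have ZV : Zs (k - 3).+1 `<=` V by have [] := HZ _ lt_l.
have [Zx1|/existsNP[x /not_implyP[Zx /eqP x1]]] :=
  EM (forall x, Zs (k - 3).+1 x -> crd x 1 = 0); last first.
  by apply: (no_chain_main irrZ clZ ltZ ZV); exists x.
have [k5|] := leqP 5 k; first exact: (no_chain_other5 irrZ clZ ltZ ZV).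
rewrite ltnS leq_eqVlt => /orP[/eqP k4|lt_k4].
  exact: (no_chain_other4 irrZ clZ ltZ ZV).
(* For k = 3 the upper right entry reads c = x_2, so a point with x_2 = 0 forces c = 0. *)
have k3 : k = 3%N by apply/eqP; rewrite eqn_leq k_ge3 -ltnS lt_k4.
have [[x Zx] _] := irrZ _ (leqnn _).
have [_ E _ _] := (Vk_eqs3 iota a b c d x k_ge3).1 (ZV x Zx).
apply: k3_c; split=> //; move: E; rewrite Zx1 // /residual elem_prod_geq ?k3 //.
rewrite map_A /adj2 one_mx2 !mx2_entries mulmx2 mx2_entries oppr0 mulr0 add0r.
by rewrite mulr1 => /eqP; rewrite fmorph_eq0 => /eqP.
Qed.

Definition coord_flat (w0 : 'A[Omega]_(k - 3)) (i : nat) : set 'A[Omega]_(k - 3) :=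
  [set w | forall j, (i <= j < k - 3)%N -> crd w j = crd w0 j].

Lemma zdim_Vk : zdim iota V (k - 3).
Proof.
split; last by move=> l Zs; apply: Vk_chain_bound.
have [t Ht] := exists_base_pt iota det1 k_ge3 k3_c.
pose w0 := base_pt iota k t; pose W := chart_dom iota a b c d (k := k).
have w0F i : (i < k - 3)%N -> exists s, crd w0 i = iota s.
  move=> lt_i; rewrite crd_vec //; case: eqP => _; first by exists t.
  by exists 0; rewrite rmorph0.
pose Y i := chart iota a b c d @` (coord_flat w0 i `&` W).
have YV i : Y i `<=` V.
  by move=> _ [w [_ Ww] <-]; apply: sub_main_part; apply: chart_main_part Ww.
exists (fun i => zclosure iota (Y i)); split=> i le_i.
  split; first exact: zclosed_zclosure.
    apply: zirreducible_zclosure; apply: chart_image_irreducible.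
      move=> w w' s Lw Lw' j /andP[le_ij lt_j].
      by rewrite crd_vec // Lw ?le_ij // Lw' ?le_ij // subrr mulr0 addr0.
    by exists w0.
  by apply: zclosure_min; [exact: zclosed_Vk | exact: YV].
split.
  apply: zclosureS => _ [w [Lw Ww] <-]; exists w => //; split=> // j /andP[le_j lt_j].
  by apply: Lw; rewrite (ltnW le_j).
move=> sub.
(* For strictness of the inclusion, w0 is moved along its i-th axis by an s that is nonzero and
   keeps the point in the domain of the chart. *)
pose w1 : 'A[Omega]_(k - 3) :=
  vec (k - 3) (fun j => if j == i then crd w0 j + 1 else crd w0 j).
have [E EE] := polyfun1_res_line iota a b c d w0 w1 0 1.
have E0 : E != 0.
  by apply: contraTneq Ht => E0; rewrite /chart_dom /= -[base_pt _ _ _](line0 _ w1)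
    EE E0 horner0 eqxx.
have /closed_nonrootP[s] : 'X * E != 0 by rewrite mulf_neq0 ?polyX_eq0.
rewrite /root hornerM hornerX mulf_eq0 negb_or => /andP[s0 Es].
pose w := line w0 w1 s.
have wj j : (j < k - 3)%N -> crd w j = crd w0 j + (if j == i then s else 0).
  move=> lt_j; rewrite crd_vec // [crd w1 j]crd_vec //; case: eqP => _; first by ring.
  by rewrite subrr mulr0.
have Yw : Y i.+1 (chart iota a b c d w).
  exists w => //; split; last by rewrite /W /chart_dom /= EE.
  move=> j /andP[lt_ij lt_j]; rewrite wj // ifN ?addr0 //.
  by rewrite gtn_eqF.
have [r wr] := w0F i le_i.
(* Parameter i is the coordinate of index i + 3 of the chart. Its constant value r on [Y i] lies in
   F, so the separating equation is over F. *)
have [p Hp] := @polyfun_crd _ _ iota k (i + 3).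
have pY : vanishes iota (p - r%:MP) (Y i).
  move=> _ [w' [Lw' Ww'] <-]; rewrite pevalD pevalN pevalC -Hp.
  rewrite -crd_proj_main // proj_main_chart // Lw' ?leqnn ?wr ?subrr //.
have := sub _ (@sub_zclosure _ _ iota _ _ _ Yw) _ pY.
rewrite pevalD pevalN pevalC -Hp -crd_proj_main // proj_main_chart // wj // eqxx wr.
by rewrite addrC addKr => /eqP; rewrite (negPf s0).
Qed.

End DimensionVk.

(** * Density of the part x_2 <> 0 *)

Section Density.
Variables (F : fieldType) (Omega : closedFieldType).
Variable iota : {rmorphism F -> Omega}.
Variable k : nat.
Variables a b c d : F.
Hypothesis det1 : a * d - c * b = 1.
Hypothesis k_ge3 : (3 <= k)%N.

Local Notation A := (mx2 a c b d).
Local Notation V := (Vk iota k A).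
Implicit Types (x : 'A[Omega]_k).

(* Deform the first m coordinates of x along f t without changing the product
   of the first m factors. *)
Lemma Vk_deform x m (f : nat -> Omega -> Omega) (D E : {poly Omega})
    (X : set 'A[Omega]_k) :
  V x -> (m <= k)%N ->
  (forall i, (i < m)%N -> loc_on [set t | D.[t] != 0] (horner D) polyfun1 (f i)) ->
  (forall t, D.[t] != 0 ->
     elem_prod 0 m (fun i => f i t) = elem_prod 0 m (crd x)) ->
  D.[0] != 0 -> (forall i, (i < m)%N -> f i 0 = crd x i) -> E != 0 ->
  (forall t y, D.[t] != 0 -> E.[t] != 0 -> V y ->
     (forall i, (i < m)%N -> crd y i = f i t) -> X y) ->
  zclosure iota X x.
Proof.
move=> Vx le_mk locf prodf D0 f0 E0 fX.
pose gam t : 'A[Omega]_k := vec k (fun i => if (i < m)%N then f i t else crd x i).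
have gam0 : gam 0 = x.
  by apply: eq_crd => i lt_i; rewrite crd_vec //; case: ifP => // /f0.
have crd_gam t i : (i < m)%N -> crd (gam t) i = f i t.
  by move=> lt_i; rewrite crd_vec ?lt_i // (leq_trans lt_i).
rewrite -gam0; apply: (curve_adherent (D := D) (E := E)) => // [i|t Dt Et].
  rewrite (coord_crd_fun gam); case: (ltnP i m) => [lt_i|ge_i].
    rewrite (_ : (fun t => _) = f i); first exact: locf.
    by apply/funext => t; rewrite crd_gam.
  apply: loc_on_base; exists (crd x i)%:P => t.
  by rewrite crd_vec ?ltn_ord // ltnNge ge_i hornerC.
apply: (fX t) => //; last exact: crd_gam.
apply/(Vk_residual iota a b c d _ le_mk).
rewrite (eq_elem_prod (g := fun i => f i t)); last by move=> j /crd_gam.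
rewrite prodf // -((Vk_residual iota a b c d x le_mk).1 Vx).
apply: eq_residual => j /andP[le_mj lt_jk].
by rewrite crd_vec // ltnNge le_mj.
Qed.

Local Notation Vmain := (main_part (k := k) iota a b c d).

(** With M = L(x_3) U(x_4) L(x_5), the new x_3, x_4, x_5 are those of the three-factor formula for
    U(-t) M, which compensates x_2 = t. The lower row of M is (w, e), so the upper right entry
    becomes D = x_4 - e t, nonzero at t = 0. *)
Lemma main_part_dense_x4 x : (5 <= k)%N -> V x -> crd x 1 = 0 -> crd x 3 != 0 ->
  zclosure iota Vmain x.
Proof.
move=> k5 Vx x1 x3.
pose e := 1 + crd x 2 * crd x 3.
pose D : {poly Omega} := (crd x 3)%:P - e *: 'X.
pose w := crd x 2 + crd x 4 + crd x 2 * crd x 3 * crd x 4.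
have DE t : D.[t] = crd x 3 - e * t by rewrite !hornerE.
pose f i t := match i with
  | 0 => crd x 0 | 1 => t | 2 => crd x 2 * crd x 3 / D.[t] | 3 => D.[t]
  | _ => (crd x 3 * crd x 4 - w * t) / D.[t] end%N.
have D0 : D.[0] != 0 by rewrite DE mulr0 subr0.
apply: (Vk_deform (m := 5) (f := f) (D := D) (E := 'X)) => //.
- have locV g : polyfun1 g ->
    loc_on [set t | D.[t] != 0] (horner D) polyfun1 (fun t => g t / D.[t]).
    by apply: loc_on_div.
  case=> [|[|[|[|[|//]]]]] _ /=.
  + exact/loc_on_base/polyfun1_const.
  + exact/loc_on_base/polyfun1_id.
  + exact/locV/polyfun1_const.
  + by apply: loc_on_base; exists D.
  + by apply: locV; exists ((crd x 3 * crd x 4)%:P - w *: 'X) => t; rewrite !hornerE.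
- move=> t Dt; rewrite [RHS]elem_prod05 //.
  rewrite 5?elem_prod_recl // elem_prod_geq // mulr1 /elem_factor /= !mulmx2.
  by congr mx2; move: Dt; rewrite DE /e /w => Dt; field.
- case=> [|[|[|[|[|//]]]]] _ //=; rewrite DE mulr0 subr0 //.
  + by rewrite mulfK.
  + by rewrite mulr0 subr0 mulrAC mulfV // mul1r.
- by rewrite polyX_eq0.
- move=> t y _; rewrite hornerX => t0 Vy fy.
  by split=> //=; rewrite (fy 1%N).
Qed.

(** With x_2 = t and x_3 kept, the new x_4, x_5, x_6 factor L(-x_3) U(-t) L(x_3 + x_5) U(x_6) as U L
    U. Its lower left entry, which is the new x_5, is D = x_5 + e t, and the diagonal entries give
    x_4 and x_6 after division by D. *)
Lemma main_part_dense_x5 x : (6 <= k)%N -> V x -> crd x 1 = 0 -> crd x 3 = 0 ->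
  crd x 4 != 0 -> zclosure iota Vmain x.
Proof.
move=> k6 Vx x1 x3 x4.
pose e := crd x 2 * (crd x 2 + crd x 4).
pose D : {poly Omega} := (crd x 4)%:P + e *: 'X.
have DE t : D.[t] = crd x 4 + e * t by rewrite !hornerE.
pose g := crd x 2 ^+ 2 * crd x 5 + crd x 2 * (1 + crd x 4 * crd x 5).
pose f i t := match i with
  | 0 => crd x 0 | 1 => t | 2 => crd x 2
  | 3 => (- (crd x 2 + crd x 4) * t) / D.[t] | 4 => D.[t]
  | _ => (crd x 4 * crd x 5 + g * t) / D.[t] end%N.
have D0 : D.[0] != 0 by rewrite DE mulr0 addr0.
apply: (Vk_deform (m := 6) (f := f) (D := D) (E := 'X)) => //.
- have locV h : polyfun1 h ->
    loc_on [set t | D.[t] != 0] (horner D) polyfun1 (fun t => h t / D.[t]).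
    by apply: loc_on_div.
  case=> [|[|[|[|[|[|//]]]]]] _ /=.
  + exact/loc_on_base/polyfun1_const.
  + exact/loc_on_base/polyfun1_id.
  + exact/loc_on_base/polyfun1_const.
  + by apply: locV; exists (- (crd x 2 + crd x 4) *: 'X) => t; rewrite !hornerE.
  + by apply: loc_on_base; exists D.
  + by apply: locV; exists ((crd x 4 * crd x 5)%:P + g *: 'X) => t; rewrite !hornerE.
- move=> t Dt.
  rewrite 6?elem_prod_recl // elem_prod_geq // 6?elem_prod_recl // elem_prod_geq //.
  rewrite !mulr1 /elem_factor /= x1 x3 !mulmx2.
  by congr mx2; move: Dt; rewrite DE /e /g => Dt; field.
- case=> [|[|[|[|[|[|//]]]]]] _ //=; rewrite DE !mulr0 ?addr0 ?mul0r //.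
  by rewrite mulrAC mulfV // mul1r.
- by rewrite polyX_eq0.
- move=> t y _; rewrite hornerX => t0 Vy fy.
  by split=> //=; rewrite (fy 1%N).
Qed.

(* On the locus x_2 = 0 move, with the product fixed: (x_2, x_3, x_4, x_5) if
   x_4 != 0; (x_2, x_4, x_5, x_6) if x_4 = 0 and x_5 != 0; and (x_3, x_5), so as
   to make x_5 nonzero, if x_4 = x_5 = 0. *)
Lemma main_part_dense6 : (6 <= k)%N -> V `<=` zclosure iota Vmain.
Proof.
move=> k6 x Vx; have [x1|x1] := eqVneq (crd x 1) 0; last first.
  exact: sub_zclosure.
have [x3|x3] := eqVneq (crd x 3) 0; last exact: main_part_dense_x4 (ltnW k6) _ _ _.
have [x4|x4] := eqVneq (crd x 4) 0; last exact: main_part_dense_x5.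
rewrite -(zclosure_idem iota Vmain).
pose f i (t : Omega) := match i with
  | 0%N => crd x 0 | 2%N => crd x 2 - t | 1%N | 3%N => 0 | _ => t end.
apply: (Vk_deform (m := 5) (f := f) (D := 1) (E := 'X)) => //.
- exact: ltnW.
- move=> i _; apply: loc_on_base.
  case: i => [|[|[|[|i]]]] /=; try exact: polyfun1_const; last exact: polyfun1_id.
  by exists ((crd x 2)%:P - 'X) => t; rewrite !hornerE.
- move=> t _; rewrite elem_prod05 // [RHS]elem_prod05 // /f x3 x4.
  by congr mx2; ring.
- by rewrite hornerC oner_neq0.
- by case=> [|[|[|[|[|//]]]]] _ //=; rewrite subr0.
- by rewrite polyX_eq0.
- move=> t y _; rewrite hornerX => t0 Vy fy.
  by apply: main_part_dense_x5; rewrite // fy.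
Qed.

(** For k <= 5 the points that cannot be moved are exactly those that pin A down: x_2 = 0 gives c =
    0 if k = 3 and a = 1 if k = 4, and x_2 = x_4 = 0 gives A = L(b) if k = 5. *)
Lemma main_part_dense : ~ (k = 3%N /\ c = 0) -> ~ (k = 4%N /\ a = 1) ->
  ~ (k = 5%N /\ A = Lmx b) -> V `<=` zclosure iota Vmain.
Proof.
move=> k3_c k4_a k5_A; have [/main_part_dense6 //|] := leqP 6 k.
rewrite leq_eqVlt => /orP[/eqP [k5]|lt_k5] x Vx.
  have [x1|x1] := eqVneq (crd x 1) 0; last exact: sub_zclosure.
  have k5' : (5 <= k)%N by rewrite k5.
  apply: main_part_dense_x4 => //; apply/eqP => x3; apply: k5_A; split=> //.
  have := (Vk_residual iota a b c d x k5').1 Vx.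
  rewrite elem_prod05 // /residual elem_prod_geq ?k5 //.
  rewrite map_A /adj2 one_mx2 !mx2_entries mulmx2 mx2_inj x3 => -[].
  rewrite ?oppr0 ?mulr0 ?mulr1 ?mul0r ?addr0 ?add0r.
  move=> /eqP; rewrite fmorph_eq1 => /eqP ->.
  move=> /eqP; rewrite fmorph_eq0 => /eqP ->.
  by move=> _ /eqP; rewrite fmorph_eq1 => /eqP ->.
have [x1|x1] := eqVneq (crd x 1) 0; last exact: sub_zclosure.
move: lt_k5; rewrite ltnS leq_eqVlt => /orP[/eqP [k4]|lt_k4].
- have k4' : (4 <= k)%N by rewrite k4.
  have := (Vk_residual iota a b c d x k4').1 Vx.
  rewrite elem_prod04 // /residual elem_prod_geq ?k4 //.
  rewrite map_A /adj2 one_mx2 !mx2_entries mulmx2 mx2_inj => -[].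
  rewrite oppr0 mulr0 addr0 mulr1 => /eqP.
  by rewrite fmorph_eq1 => /eqP a1; case: k4_a.
- have k3 : k = 3%N by move: k_ge3 lt_k4; lia.
  have [_ E _ _] := (Vk_eqs3 iota a b c d x k_ge3).1 Vx.
  case: k3_c; split=> //; move: E; rewrite x1 /residual elem_prod_geq ?k3 //.
  rewrite map_A /adj2 one_mx2 !mx2_entries mulmx2 mx2_entries oppr0 mulr0 add0r.
  by rewrite mulr1 => /eqP; rewrite fmorph_eq0 => /eqP.
Qed.

End Density.

(** * Birational maps *)

Section Birational.
Variables (F : fieldType) (Omega : closedFieldType).
Variable iota : {rmorphism F -> Omega}.
Variable k : nat.
Implicit Types (X U Y Z : set 'A[Omega]_k).

Lemma zopen_in_self U : zopen_in iota U U.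
Proof.
exists [set x | peval iota (1 : {mpoly F[k]}) x = 0]; split.
  exact: zclosed_zeros.
apply/seteqP; split=> x; last by case.
move=> Ux; split=> //=; rewrite -mpolyC1 pevalC rmorph1.
by apply/eqP; rewrite oner_eq0.
Qed.

Lemma regular_fun_div U f p q : polyfun iota p -> polyfun iota q ->
  (forall x, U x -> q x != 0 /\ f x = p x / q x) -> regular_fun iota U f.
Proof.
move=> [P HP] [Q HQ] fpq x Ux; exists U, P, Q; split=> //.
  exact: zopen_in_self.
by move=> y /fpq; rewrite HP HQ.
Qed.

Lemma regular_fun_polyfun U f : polyfun iota f -> regular_fun iota U f.
Proof.
move=> Pf; apply: (regular_fun_div Pf (fsub1 (polyfun_subring iota k))) => x _.
by rewrite oner_neq0 divr1.
Qed.

Lemma zdense_in_self U : zdense_in iota U U.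
Proof. by split. Qed.

Lemma birational_polynomial_iso n Z (phi : 'A[Omega]_k -> 'A[Omega]_n)
    (psi : 'A[Omega]_n -> 'A[Omega]_k) :
  (forall i, polyfun iota (fun x => phi x i)) ->
  (forall i, polyfun iota (fun x => psi x i)) ->
  (forall x, Z x -> psi (phi x) = x) ->
  (forall y, Z (psi y) /\ phi (psi y) = y) ->
  birational_to_affine iota Z phi.
Proof.
move=> polphi polpsi phiK psiK; exists Z, setT, psi; split.
- by split; [exact: zopen_in_self | exact: zdense_in_self].
- split; last by split.
  exists set0; split; last by rewrite setD0.
  have -> : set0 = [set x : 'A[Omega]_n | peval iota (1 : {mpoly F[n]}) x = 0].
    apply/seteqP; split=> x //=; rewrite -mpolyC1 pevalC rmorph1 => /eqP.
    by rewrite oner_eq0.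
  exact: zclosed_zeros.
- split=> i; first exact: regular_fun_polyfun.
  move=> x _; have [p Hp] := polpsi i.
  exists setT, p, 1; split=> //; last first.
    by move=> y _; rewrite -mpolyC1 pevalC rmorph1 oner_neq0 divr1 Hp.
  exists [set x | peval iota (1 : {mpoly F[n]}) x = 0]; split.
    exact: zclosed_zeros.
  apply/seteqP; split=> y // _; split=> //=; rewrite -mpolyC1 pevalC rmorph1.
  by apply/eqP; rewrite oner_eq0.
- by move=> x Zx; split=> //; apply: phiK.
- by move=> y _; apply: psiK.
Qed.

Lemma lines_irreducible X : X !=set0 ->
  (forall x y t, X x -> X y -> X (line x y t)) -> zirreducible iota X.
Proof.
move=> X0 linX; apply: (curves_irreducible iota) => // x y Xx Xy.
exists 1, 1, (line x y), 0, 1; split.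
- move=> i; rewrite (coord_crd_fun (line x y)).
  by apply: loc_on_base; apply: polyfun1_line.
- exact: oner_neq0.
- by move=> t _ _; apply: linX.
- by rewrite hornerC oner_neq0 line0.
- by rewrite hornerC oner_neq0 line1.
Qed.

Lemma two_components X Z1 Z2 : X = Z1 `|` Z2 ->
  zclosed iota Z1 -> zclosed iota Z2 ->
  zirreducible iota Z1 -> zirreducible iota Z2 ->
  ~ Z1 `<=` Z2 -> ~ Z2 `<=` Z1 ->
  [/\ ~ zirreducible iota X, irreducible_component iota X Z1,
      irreducible_component iota X Z2 & Z1 <> Z2].
Proof.
move=> -> cl1 cl2 irr1 irr2 n12 n21; split.
- move=> [_ /(_ Z1 Z2 cl1 cl2 (@subset_refl _ _))] [|] sub.
    by apply: n21 => x Zx; apply: sub; right.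
  by apply: n12 => x Zx; apply: sub; left.
- split=> // Y clY irrY YX Z1Y.
  have [_ /(_ Z1 Z2 cl1 cl2 YX)] := irrY.
  case=> sub; first by apply/seteqP.
  by case: n12; apply: subset_trans sub.
- split=> // Y clY irrY YX Z2Y.
  have [_ /(_ Z1 Z2 cl1 cl2 YX)] := irrY.
  case=> sub; last by apply/seteqP.
  by case: n21; apply: subset_trans sub.
- by move=> E; apply: n12; rewrite E.
Qed.

End Birational.

Section MainChart.
Variables (F : fieldType) (Omega : closedFieldType).
Variable iota : {rmorphism F -> Omega}.
Variable k : nat.
Variables a b c d : F.
Hypothesis det1 : a * d - c * b = 1.
Hypothesis k_ge3 : (3 <= k)%N.
Hypothesis k3_c : ~ (k = 3%N /\ c = 0).

Local Notation A := (mx2 a c b d).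
Local Notation V := (Vk iota k A).

Lemma birational_main : V `<=` zclosure iota (main_part iota a b c d) ->
  birational_to_affine iota V (@proj_main Omega k).
Proof.
move=> dense.
exists (main_part iota a b c d), (chart_dom iota a b c d), (chart iota a b c d).
split.
- split; first exact: main_part_open.
  by apply: zdense_in_closure => //; apply: sub_main_part.
- by split; [exact: chart_dom_open | exact: chart_dom_dense].
- split=> i.
    apply: regular_fun_polyfun; under eq_fun do rewrite ffunE.
    exact: polyfun_crd.
  have HS := polyfun_subring iota (k - 3).
  have S1 := fsub1 HS.
  have Pr := polyfun_res_of iota k a b c d.
  case: i => [[|[|[|i]]] lt_i].
  + apply: (regular_fun_div (p := fun w => res_of iota a b c d w 1 1 - 1)
      (q := fun w => res_of iota a b c d w 0 1)) => [||w Ww].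
    * by apply: (fsubB HS).
    * exact: Pr.
    * by rewrite ffunE.
  + apply: regular_fun_polyfun; under eq_fun do rewrite ffunE; exact: Pr.
  + apply: (regular_fun_div (p := fun w => res_of iota a b c d w 0 0 - 1)
      (q := fun w => res_of iota a b c d w 0 1)) => [||w Ww].
    * by apply: (fsubB HS).
    * exact: Pr.
    * by rewrite ffunE.
  + apply: regular_fun_polyfun; under eq_fun do rewrite ffunE.
    exact: polyfun_crd.
- by move=> x /main_part_proj; apply.
- by move=> w Ww; split; [exact: chart_main_part | exact: proj_main_chart].
Qed.

End MainChart.

(** * The reducible cases *)

(** Two closed irreducible sets, neither inside the other, are the irreducible components of their
    union; incomparability is the form that is easy to check. *)
Definition splits_in_two (F : fieldType) (Omega : closedFieldType)
    (iota : {rmorphism F -> Omega}) k (X : set 'A[Omega]_k) : Prop :=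
  exists Z1 Z2 : set 'A[Omega]_k,
    [/\ X = Z1 `|` Z2, zclosed iota Z1 /\ zclosed iota Z2,
        zirreducible iota Z1 /\ zirreducible iota Z2,
        ~ Z1 `<=` Z2 /\ ~ Z2 `<=` Z1 &
        birational_to_affine iota Z1 (@proj_main Omega k) /\
        birational_to_affine iota Z2 (@proj_other Omega k)].

Section ReducibleCases.
Variables (F : fieldType) (Omega : closedFieldType).
Variable iota : {rmorphism F -> Omega}.

Lemma polyfun_vec_seq n m (s : seq ('A[Omega]_n -> Omega)) (i : 'I_m) :
  (forall j, polyfun iota (nth (fun=> 0) s j)) ->
  polyfun iota (fun w => vec m (fun l => nth (fun=> 0) s l w) i).
Proof. by move=> Ps; under eq_fun do rewrite ffunE; apply: Ps. Qed.

Lemma polyfun_proj_main k i :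
  polyfun iota (fun x : 'A[Omega]_k => proj_main x i).
Proof. by under eq_fun do rewrite ffunE; apply: polyfun_crd. Qed.

Lemma polyfun_proj_other k i :
  polyfun iota (fun x : 'A[Omega]_k => proj_other x i).
Proof. by under eq_fun do rewrite ffunE; apply: polyfun_crd. Qed.

Ltac polyfun_tac :=
  lazymatch goal with
  | |- polyfun _ (fun x => crd x _) => exact: polyfun_crd
  | |- polyfun _ (fun x => _ + _) => apply: (fsubD (polyfun_subring _ _)); polyfun_tac
  | |- polyfun _ (fun x => - _) => apply: (fsubN (polyfun_subring _ _)); polyfun_tac
  | |- polyfun _ (fun x => 0) => exact: (fsub0 (polyfun_subring _ _))
  | |- polyfun _ (fun x => _ _) => exact: (fsub_const (polyfun_subring _ _))
  end.

(** The upper left entry of the product is 1 + x_2 x_3, so a = 1 means x_2 x_3 = 0. The locus x_3 =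
    0 is the line x_1 = b, x_2 + x_4 = c, and x_2 = 0 is the line x_4 = c, x_1 + x_3 = b. *)
Lemma Vk4_splits (b c d : F) : d - c * b = 1 ->
  splits_in_two iota (Vk iota 4 (mx2 1 c b d)).
Proof.
move=> det1.
have dE : iota d = 1 + iota c * iota b.
  by rewrite -rmorphM -(rmorph1 iota) -rmorphD -det1 subrK.
pose Z1 := [set x : 'A[Omega]_4 | crd x 0 = iota b] `&`
  ([set x : 'A[Omega]_4 | crd x 2 = 0] `&`
   [set x : 'A[Omega]_4 | crd x 1 = iota c - crd x 3]).
pose Z2 := [set x : 'A[Omega]_4 | crd x 1 = 0] `&`
  ([set x : 'A[Omega]_4 | crd x 3 = iota c] `&`
   [set x : 'A[Omega]_4 | crd x 0 = iota b - crd x 2]).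
pose psi1 (w : 'A[Omega]_(4 - 3)) : 'A[Omega]_4 := vec 4 (fun i => nth (fun=> 0)
  [:: (fun=> iota b); (fun w => iota c - crd w 0); (fun=> 0); (fun w => crd w 0)] i w).
pose psi2 (w : 'A[Omega]_(4 - 3)) : 'A[Omega]_4 := vec 4 (fun i => nth (fun=> 0)
  [:: (fun w => iota b - crd w 0); (fun=> 0); (fun w => crd w 0); (fun=> iota c)] i w).
have Zpsi1 w : Z1 (psi1 w) by rewrite /Z1 /= !crd_vec.
have Zpsi2 w : Z2 (psi2 w) by rewrite /Z2 /= !crd_vec.
exists Z1, Z2; split.
- apply/seteqP; split=> x.
    move/VkE; rewrite map_A 4?elem_prod_recl // elem_prod_geq // mulr1.
    rewrite /elem_factor /= !mulmx2 mx2_inj rmorph1 => -[E00 E01 E10 E11].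
    have : crd x 1 * crd x 2 = 0.
      by apply: (addrI 1); rewrite addr0 [RHS]E00; ring.
    move=> /eqP; rewrite mulf_eq0 => /orP[/eqP x1|/eqP x2]; [right|left].
      by split=> //; split; rewrite /= ?E01 ?E10 x1; ring.
    by split; rewrite /= ?E10 ?x2; [ring | split; rewrite //= E01 x2; ring].
  move=> Zx; apply/VkE; rewrite map_A 4?elem_prod_recl // elem_prod_geq // mulr1.
  rewrite /elem_factor /= !mulmx2 rmorph1 dE.
  by case: Zx => [[/= -> [/= -> /= ->]]|[/= -> [/= -> /= ->]]]; congr mx2; ring.
- by split; do !apply: zclosedI; apply: zclosed_polyfun_eq; polyfun_tac.
- split; apply: lines_irreducible; try by [exists (psi1 0) | exists (psi2 0)].
    move=> x y t [/= x0 [/= x2 x1]] [/= y0 [/= y2 y1]].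
    by split; [|split]; rewrite /= !crd_vec // ?x0 ?y0 ?x1 ?x2 ?y1 ?y2; ring.
  move=> x y t [/= x1 [/= x3 x0]] [/= y1 [/= y3 y0]].
  by split; [|split]; rewrite /= !crd_vec // ?x0 ?y0 ?x1 ?x3 ?y1 ?y3; ring.
- have nz : (1 : Omega) <> 0 by apply/eqP/oner_neq0.
  split=> sub.
    (* At x_4 = c - 1 the first line has x_2 = 1, hence leaves the second. *)
    have [/= + _] := sub _ (Zpsi1 (vec _ (fun=> iota c - 1))).
    by rewrite !crd_vec //= crd_vec // opprB addrC subrK.
  have [/= _ [/= + _]] := sub _ (Zpsi2 (vec _ (fun=> 1))).
  by rewrite crd_vec //= crd_vec.
- split.
    apply: (birational_polynomial_iso (psi := psi1)) => [i|i|x|w].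
    + exact: polyfun_proj_main.
    + by apply: polyfun_vec_seq => -[|[|[|[|[|j]]]]] /=; polyfun_tac.
    + move=> [/= x0 [/= x2 x1]]; apply: eq_crd => i lt_i.
      by case: i lt_i => [|[|[|[|//]]]] _; rewrite crd_vec //= ?crd_proj_main //
        ?x0 ?x1 ?x2.
    + split=> //; apply: eq_crd => -[|//] _.
      by rewrite crd_proj_main // crd_vec.
  apply: (birational_polynomial_iso (psi := psi2)) => [i|i|x|w].
  + exact: polyfun_proj_other.
  + by apply: polyfun_vec_seq => -[|[|[|[|[|j]]]]] /=; polyfun_tac.
  + move=> [/= x1 [/= x3 x0]]; apply: eq_crd => i lt_i.
    by case: i lt_i => [|[|[|[|//]]]] _; rewrite crd_vec //= ?crd_proj_other //
      ?x0 ?x1 ?x3.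
  + split=> //; apply: eq_crd => -[|//] _.
    by rewrite crd_proj_other // crd_vec.
Qed.

(** Removing L(x_5) leaves a matrix L(b - x_5), with upper row (1, 0), so again x_2 x_3 = 0. Then
    x_2 = 0 forces x_4 = 0, and x_3 = 0 forces x_2 = -x_4; both loci are planes. *)
Lemma Vk5_splits (b : F) : splits_in_two iota (Vk iota 5 (Lmx b)).
Proof.
pose Z1 := [set x : 'A[Omega]_5 | crd x 0 = iota b - crd x 4] `&`
  ([set x : 'A[Omega]_5 | crd x 2 = 0] `&`
   [set x : 'A[Omega]_5 | crd x 1 = - crd x 3]).
pose Z2 := [set x : 'A[Omega]_5 | crd x 1 = 0] `&`
  ([set x : 'A[Omega]_5 | crd x 3 = 0] `&`
   [set x : 'A[Omega]_5 | crd x 0 = iota b - crd x 2 - crd x 4]).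
pose psi1 (w : 'A[Omega]_(5 - 3)) : 'A[Omega]_5 := vec 5 (fun i => nth (fun=> 0)
  [:: (fun w => iota b - crd w 1); (fun w => - crd w 0); (fun=> 0);
      (fun w => crd w 0); (fun w => crd w 1)] i w).
pose psi2 (w : 'A[Omega]_(5 - 3)) : 'A[Omega]_5 := vec 5 (fun i => nth (fun=> 0)
  [:: (fun w => iota b - crd w 0 - crd w 1); (fun=> 0); (fun w => crd w 0);
      (fun=> 0); (fun w => crd w 1)] i w).
have Zpsi1 w : Z1 (psi1 w) by rewrite /Z1 /= !crd_vec.
have Zpsi2 w : Z2 (psi2 w) by rewrite /Z2 /= !crd_vec.
exists Z1, Z2; split.
- apply/seteqP; split=> x.
    move/VkE; rewrite map_A 5?elem_prod_recl // elem_prod_geq // mulr1.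
    rewrite /elem_factor /= !mulmx2 mx2_inj rmorph1 rmorph0 => -[E00 E01 E10 E11].
    have x13 : crd x 1 + (1 + crd x 1 * crd x 2) * crd x 3 = 0.
      by rewrite [RHS]E01; ring.
    have : crd x 1 * crd x 2 = 0.
      apply: (addrI 1); rewrite addr0 [RHS]E00.
      transitivity (1 + crd x 1 * crd x 2 +
        (crd x 1 + (1 + crd x 1 * crd x 2) * crd x 3) * crd x 4); last by ring.
      by rewrite x13; ring.
    move=> /eqP; rewrite mulf_eq0 => /orP[/eqP x1|/eqP x2]; [right|left].
      have x3 : crd x 3 = 0 by move: x13; rewrite x1 => <-; ring.
      by split=> //; split; rewrite //= E10 x1 x3; ring.
    have x1 : crd x 1 = - crd x 3.
      by apply/eqP; rewrite -addr_eq0 -x13 x2; apply/eqP; ring.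
    by split; [rewrite /= E10 x2 x1; ring | split].
  move=> Zx; apply/VkE; rewrite map_A 5?elem_prod_recl // elem_prod_geq // mulr1.
  rewrite /elem_factor /= !mulmx2 rmorph1 rmorph0.
  by case: Zx => [[/= -> [/= -> /= ->]]|[/= -> [/= -> /= ->]]]; congr mx2; ring.
- by split; do !apply: zclosedI; apply: zclosed_polyfun_eq; polyfun_tac.
- split; apply: lines_irreducible; try by [exists (psi1 0) | exists (psi2 0)].
    move=> x y t [/= x0 [/= x2 x1]] [/= y0 [/= y2 y1]].
    by split; [|split]; rewrite /= !crd_vec // ?x0 ?y0 ?x1 ?x2 ?y1 ?y2; ring.
  move=> x y t [/= x1 [/= x3 x0]] [/= y1 [/= y3 y0]].
  by split; [|split]; rewrite /= !crd_vec // ?x0 ?y0 ?x1 ?x3 ?y1 ?y3; ring.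
- have nz : (1 : Omega) <> 0 by apply/eqP/oner_neq0.
  split=> sub.
    have [/= _ [/= + _]] := sub _ (Zpsi1 (vec _ (fun=> 1))).
    by rewrite !crd_vec //= crd_vec.
  have [/= _ [/= + _]] := sub _ (Zpsi2 (vec _ (fun=> 1))).
  by rewrite crd_vec //= crd_vec.
- split.
    apply: (birational_polynomial_iso (psi := psi1)) => [i|i|x|w].
    + exact: polyfun_proj_main.
    + by apply: polyfun_vec_seq => -[|[|[|[|[|[|j]]]]]] /=; polyfun_tac.
    + move=> [/= x0 [/= x2 x1]]; apply: eq_crd => i lt_i.
      by case: i lt_i => [|[|[|[|[|//]]]]] _; rewrite crd_vec //= ?crd_proj_main //
        ?x0 ?x1 ?x2.
    + split=> //; apply: eq_crd => -[|[|//]] _;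
      by rewrite crd_proj_main // crd_vec.
  apply: (birational_polynomial_iso (psi := psi2)) => [i|i|x|w].
  + exact: polyfun_proj_other.
  + by apply: polyfun_vec_seq => -[|[|[|[|[|[|j]]]]]] /=; polyfun_tac.
  + move=> [/= x1 [/= x3 x0]]; apply: eq_crd => i lt_i.
    by case: i lt_i => [|[|[|[|[|//]]]]] _; rewrite crd_vec //= ?crd_proj_other //
      ?x0 ?x1 ?x3.
  + split=> //; apply: eq_crd => -[|[|//]] _;
    by rewrite crd_proj_other // crd_vec.
Qed.

End ReducibleCases.

(** * Structure of V_k(A) *)

Section Structure.
Variables (F : fieldType) (Omega : closedFieldType).
Variable iota : {rmorphism F -> Omega}.
Variable k : nat.
Variables a b c d : F.
Hypothesis det1 : a * d - c * b = 1.
Hypothesis k_ge3 : (3 <= k)%N.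

Local Notation A := (mx2 a c b d).
Local Notation V := (Vk iota k A).

Lemma Vk_dichotomy : ~ (k = 3%N /\ c = 0) ->
  let reducible := (k = 4%N /\ a = 1) \/ (k = 5%N /\ A = Lmx b) in
  [/\ ~ reducible, zirreducible iota V &
      birational_to_affine iota V (@proj_main Omega k)] \/
  (reducible /\ splits_in_two iota V).
Proof.
move=> k3_c reducible; have [red|nred] := EM reducible; [right|left].
  split=> //; case: red => [[-> a1]|[-> ->]]; last exact: Vk5_splits.
  by move: det1; rewrite a1 mul1r; apply: Vk4_splits.
have dense : V `<=` zclosure iota (main_part iota a b c d).
  by apply: main_part_dense => // [k4_a|k5_A]; apply: nred; [left|right].
split=> //; last exact: birational_main.
apply: zirreducible_dense dense _; first exact: sub_main_part.
exact: main_part_irreducible.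
Qed.

Lemma Vk_rational_or_union : ~ (k = 3%N /\ c = 0) -> rational_or_union iota V.
Proof.
move=> /Vk_dichotomy[[_ irr bir]|[_ [Z1 [Z2 [E [cl1 cl2] [irr1 irr2] _ [bir1 bir2]]]]]].
  by left; split=> //; exists (k - 3)%N, (@proj_main Omega k).
right; exists Z1, Z2; split=> //; split=> //.
  by exists (k - 3)%N, (@proj_main Omega k).
by exists (k - 3)%N, (@proj_other Omega k).
Qed.

End Structure.

(** * The case k = 3, with the line that occurs for c = 0 *)

Section Line.
Variables (F : fieldType) (Omega : closedFieldType).
Variable iota : {rmorphism F -> Omega}.
Variables b d : F.

Lemma Vk3E (a c : F) x : Vk iota 3 (mx2 a c b d) x <->
  [/\ iota a = 1 + crd x 1 * crd x 2, iota c = crd x 1,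
      iota b = crd x 0 + crd x 2 + crd x 0 * crd x 1 * crd x 2 &
      iota d = 1 + crd x 0 * crd x 1].
Proof. by rewrite VkE elem_prod03 map_A mx2_inj. Qed.

Lemma Vk3_line x : d = 1 -> Vk iota 3 (mx2 1 0 b d) x <->
  crd x 1 = 0 /\ crd x 0 = iota b - crd x 2.
Proof.
move=> d1; rewrite Vk3E d1 rmorph1 rmorph0.
split=> [[_ <- -> _]|[-> ->]]; first by split=> //; ring.
by split; ring.
Qed.

Lemma Vk3_line_irreducible : d = 1 -> zirreducible iota (Vk iota 3 (mx2 1 0 b d)).
Proof.
move=> d1; apply: lines_irreducible => [|x y t].
  exists (vec 3 (fun i => if i == 0%N then iota b else 0)).
  by apply/Vk3_line => //; rewrite !crd_vec //= subr0.
move=> /Vk3_line -/(_ d1)[x1 x0] /Vk3_line -/(_ d1)[y1 y0].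
by apply/Vk3_line => //; rewrite !crd_vec // x1 x0 y1 y0; split; ring.
Qed.

(** The point with x_3 = 0 is defined over F, hence closed, and together with the whole line it
    forms a chain of length 1. *)
Lemma Vk3_line_zdim : d = 1 -> ~ zdim iota (Vk iota 3 (mx2 1 0 b d)) 0.
Proof.
move=> d1 [_ bound].
pose pt s : 'A[Omega]_3 := vec 3 (fun i => if i == 0%N then iota b - s else
  if i == 2%N then s else 0).
have Vpt s : Vk iota 3 (mx2 1 0 b d) (pt s).
  by apply/Vk3_line => //; rewrite !crd_vec.
have := bound 1%N (fun i => if i == 0%N then [set pt 0] else Vk iota 3 (mx2 1 0 b d)).
rewrite ltnn => chain; suff : false by []; apply: chain; split=> -[|[|//]] //= _.
- split; last by move=> _ ->.
    have -> : [set pt 0] = Vk iota 3 (mx2 1 0 b d) `&`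
        [set x : 'A[Omega]_3 | crd x 2 = 0].
      apply/seteqP; split=> [_ ->|x [/Vk3_line -/(_ d1)[x1 x0] /= x2]].
        by split=> //=; rewrite crd_vec.
      apply: eq_crd => -[|[|[|//]]] _; rewrite crd_vec //=.
      by rewrite x0 x2.
    apply: zclosedI; first exact: zclosed_Vk.
    apply: zclosed_polyfun_eq; first exact: polyfun_crd.
    exact: (fsub0 (polyfun_subring _ _)).
  exact: zirreducible_set1.
- by split=> //; [exact: zclosed_Vk | exact: Vk3_line_irreducible].
- split; first by move=> _ ->.
  move=> /(_ _ (Vpt 1)) /(congr1 (fun x => crd x 2)).
  by rewrite !crd_vec //= => /eqP; rewrite oner_eq0.
Qed.

End Line.

(** * Fibration by the last coordinate *)

Section Fibration.

Lemma map_elem_factor (R R' : nzRingType) (f : {rmorphism R -> R'}) j x :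
  map_mx f (elem_factor j x) = elem_factor j (f x).
Proof.
rewrite /elem_factor; case: odd; apply/matrixP => i l; rewrite !mxE;
  by case: ifP => _; case: ifP => _; rewrite ?rmorph0 ?rmorph1.
Qed.

Lemma elem_factor_unit (R : comUnitRingType) j (x : R) :
  elem_factor j x \in unitmx.
Proof. by rewrite unitmxE det_elem_factor unitr1. Qed.

Lemma fiber_last_Vk (F : fieldType) (Omega : closedFieldType)
    (iota : {rmorphism F -> Omega}) k (A : 'M[F]_2) t :
  fiber_last (Vk iota k.+1 A) (iota t) =
  Vk iota k (A *m invmx (elem_factor k t)).
Proof.
have prodE x : \prod_(j < k.+1) elem_factor j (append_coord x (iota t) j) =
    \prod_(j < k) elem_factor j (x j) *m elem_factor k (iota t).
  rewrite big_ord_recr /=; congr (_ * elem_factor _ _); last first.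
    by rewrite ffunE unlift_none.
  apply: eq_bigr => j _; rewrite ffunE.
  have -> : widen_ord (leqnSn k) j = lift ord_max j.
    by apply: val_inj; rewrite /= /bump leqNgt ltn_ord.
  by rewrite liftK.
have uE := elem_factor_unit k (iota t).
apply/seteqP; split=> x; rewrite /fiber_last /Vk /= prodE map_mxM map_invmx
    map_elem_factor.
  by move=> ->; rewrite -mulmxA mulmxV // mulmx1.
by move=> <-; rewrite -mulmxA mulVmx // mulmx1.
Qed.

(** The induction generalises over F, since the fiber lives over F'. The only fibers to discard are
    those in the case k = 3, c = 0, which can arise only from four coordinates: the upper right
    entry of A U(t)^-1 is c - a t, so g = c - a X, nonzero because the determinant is 1. Otherwise g
    = 1. *)
Lemma inductively_fibered_SL2 k (F : fieldType) (A : 'M[F]_2) :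
  \det A = 1 -> inductively_fibered k A.
Proof.
elim: k F A => [//|k IHk] F A detA /= k4.
have [g g0 gE] : exists2 g : {poly F}, g != 0 & k = 3%N ->
    g = (A 0 1)%:P - (A 0 0) *: 'X.
  have [k3|] := eqVneq k 3%N; last first.
    by move=> k3; exists 1; rewrite ?oner_neq0 // => /eqP; rewrite (negPf k3).
  exists ((A 0 1)%:P - (A 0 0) *: 'X) => //; apply: contra_eq_neq detA => g0.
  have c0 := congr1 (fun p : {poly F} => p`_0) g0.
  have a0 := congr1 (fun p : {poly F} => p`_1) g0.
  move: a0 c0; rewrite !coefB !coefZ !coefC !coefX /= mulr0 mulr1 subr0 sub0r.
  move=> /eqP; rewrite oppr_eq0 => /eqP a0 c0.
  by rewrite [A]mx2_eta det_mx2 a0 c0 !mul0r subrr eq_sym oner_neq0.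
exists g => // F' i t gt; set A' := map_mx i A; set B := A' *m _.
have detB : \det B = 1.
  rewrite /B det_mulmx det_inv det_elem_factor invr1 mulr1.
  by rewrite det_map_mx detA rmorph1.
split; first exact: IHk.
move=> Omega iota; rewrite fiber_last_Vk -/B.
have detB' : B 0 0 * B 1 1 - B 0 1 * B 1 0 = 1 by rewrite -det_mx2 -mx2_eta.
have k3_c : ~ (k = 3%N /\ B 0 1 = 0).
  move=> [k3 c0]; move: gt; rewrite gE // => /negP; apply.
  have EA : A' = B * elem_factor k t.
    by rewrite /B -mulmxE mulmxKV // elem_factor_unit.
  have : A' = mx2 (B 0 0) 0 (B 1 0) (B 1 1) * elem_factor k t.
    by rewrite EA {1}[B]mx2_eta c0.
  rewrite k3 /elem_factor /= mulmx2 => E.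
  have := congr1 (fun M : 'M_2 => M 0 0) E; have := congr1 (fun M : 'M_2 => M 0 1) E.
  rewrite !mx2_entries !mxE !mulr0 !mulr1 !addr0 => E1 E0.
  rewrite /root rmorphB /= map_polyC map_polyZ map_polyX /= !hornerE /=.
  by rewrite E0 E1 subrr.
have k_ge3 : (3 <= k)%N by [].
move: (B) detB' k3_c => C detC k3_c.
rewrite [C]mx2_eta subSS; split=> //; last exact: Vk_rational_or_union.
exact: zdim_Vk.
Qed.

End Fibration.

Theorem proposition3p1 (K : fieldExtType rat) (S : seq (nf_prime K))
    (S_arch : forall s : {rmorphism K -> algC}, in_primes S (ArchPrime s))
    (a b c d : K) (A : 'M[K]_2) (A_def : A = mx2 a c b d)
    (A_SL2 : SL2 (S_integers S) A)
    (Omega : closedFieldType) (iota : {rmorphism K -> Omega})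
    (k : nat) (k_ge3 : (3 <= k)%N) :
  let V := Vk iota k A in
  [/\ zdim iota V (k - 3) <-> ~ (k = 3%N /\ c = 0),
      ~ (k = 3%N /\ c = 0 /\ a <> 1) ->
        (zirreducible iota V <->
         ~ ((k = 4%N /\ a = 1) \/ (k = 5%N /\ A = Lmx b))) &
      ~ (k = 3%N /\ c = 0) ->
        [/\ zirreducible iota V ->
              rational_variety iota V /\
              birational_to_affine iota V (@proj_main Omega k),
            ~ zirreducible iota V ->
              exists Z1 Z2 : set 'A[Omega]_k,
              [/\ V = Z1 `|` Z2 /\ Z1 <> Z2,
                  irreducible_component iota V Z1 /\
                  irreducible_component iota V Z2,
                  rational_variety iota Z1 /\ rational_variety iota Z2,
                  birational_to_affine iota Z1 (@proj_main Omega k) &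
                  birational_to_affine iota Z2 (@proj_other Omega k)] &
            inductively_fibered k A]].
Proof.
have detA : \det A = 1 by case: A_SL2.
have det1 : a * d - c * b = 1 by rewrite -det_mx2 -A_def.
rewrite A_def in detA *; move=> V; split.
(* If k = 3 and c = 0, the equations give x_2 = 0 and hence a = 1: V is a line for a = 1 and is
   empty otherwise, and in neither case has it dimension 0. *)
- split=> [dimV [k3 c0]|]; last exact: zdim_Vk.
  rewrite /V c0 in dimV; move: det1; rewrite c0 mul0r subr0 => ad1; subst k.
  have [a1|a1] := eqVneq a 1.
    have d1 : d = 1 by rewrite -ad1 a1 mul1r.
    by rewrite a1 in dimV; apply: (Vk3_line_zdim d1 dimV).
  have [[Z [HZ _]] _] := dimV; have [_ [[x Zx] _] ZV] := HZ 0%N isT.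
  have /Vk3E[+ c1 _ _] := ZV x Zx; rewrite -c1 rmorph0 mul0r addr0 => /eqP.
  by rewrite fmorph_eq1 (negPf a1).
(* For k = 3 and c = 0 the assumption leaves a = 1, where V is an irreducible line and neither
   exceptional value of k occurs. *)
- move=> k3_ca; have [[k3 c0]|k3_c] := EM (k = 3%N /\ c = 0).
    split=> [_ [[]|[]]|_]; rewrite ?k3 //; subst k.
    have a1 : a = 1 by apply: contrapT => a1; apply: k3_ca.
    have d1 : d = 1 by move: det1; rewrite a1 c0 mul0r subr0 mul1r.
    by rewrite /V a1 c0; apply: Vk3_line_irreducible.
  have [[nred irr _]|[red [Z1 [Z2 [E [cl1 cl2] [irr1 irr2] [n12 n21] _]]]]] :=
    Vk_dichotomy iota det1 k_ge3 k3_c; first by split.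
  by have [nirr _ _ _] := two_components E cl1 cl2 irr1 irr2 n12 n21; split.
- move=> k3_c; have := Vk_dichotomy iota det1 k_ge3 k3_c; rewrite -/V.
  move=> dich; split; last exact: inductively_fibered_SL2.
    move=> irrV; case: dich => [[_ _ bir]|].
      by split=> //; split=> //; exists (k - 3)%N, (@proj_main Omega k).
    move=> [_ [Z1 [Z2 [E [cl1 cl2] [irr1 irr2] [n12 n21] _]]]].
    by have [] := two_components E cl1 cl2 irr1 irr2 n12 n21.
  move=> nirrV; case: dich => [[_ irrV]//|].
  move=> [_ [Z1 [Z2 [E [cl1 cl2] [irr1 irr2] [n12 n21] [bir1 bir2]]]]].
  have [_ comp1 comp2 neq] := two_components E cl1 cl2 irr1 irr2 n12 n21.
  exists Z1, Z2; split=> //; split; split=> //.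
    by exists (k - 3)%N, (@proj_main Omega k).
  by exists (k - 3)%N, (@proj_other Omega k).
Qed.
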